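(* Let $r \geq 1$, let $\Gamma$ be a finitely generated group, and let $\theta_1$ and $\theta_2$ be two minimal non free actions of $\Gamma$ by (orientation preserving) $C^r$ diffeomorphisms of the circle $\mathrm{S}^1$. Suppose that $\theta_1$ and $\theta_2$ are conjugated by a bi-Lipschitz (orientation preserving) circle homeomorphism $\phi: \mathrm{S}^1 \to \mathrm{S}^1$, that is, $\phi \circ \theta_1(g) = \theta_2(g) \circ \phi$ for every $g \in \Gamma$, and that $\theta_1$ and $\theta_2$ are ergodic with respect to the Lebesgue measure. Then $\phi$ is a $C^r$ diffeomorphism.
   Context: A homeomorphism $\phi$ of $\mathrm{S}^1$ is bi-Lipschitz if both $\phi$ and $\phi^{-1}$ are Lipschitz. A $C^r$ diffeomorphism is a $C^r$ homeomorphism whose inverse is also $C^r$; for non-integer $r = k + \alpha$ with $k = \lfloor r \rfloor$ and $\alpha \in (0,1)$, $C^r$ means $C^k$ with $\alpha$-Hölder continuous $k$-th derivative. An action $\theta$ of $\Gamma$ on $\mathrm{S}^1$ is minimal if every orbit is dense. It is non free if there is $g \in \Gamma$ such that $\theta(g) \neq \mathrm{id}$ and $\theta(g)$ has a fixed point on $\mathrm{S}^1$. It is ergodic with respect to the Lebesgue measure if every measurable set $A \subset \mathrm{S}^1$ with $\theta(g)(A) = A$ for all $g \in \Gamma$ has either zero or full Lebesgue measure (the Lebesgue measure is not assumed to be invariant). *)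

(* Defs.v *)
From HB Require Import structures.
From mathcomp Require Import all_boot all_order all_algebra.
From mathcomp Require Import all_classical all_reals all_analysis.

Set Implicit Arguments.
Unset Strict Implicit.
Unset Printing Implicit Defensive.

Import Order.TTheory GRing.Theory Num.Theory.
Import numFieldNormedType.Exports.

Local Open Scope ring_scope.
Local Open Scope classical_set_scope.
Local Open Scope quotient_scope.

Section circle.
Variable R : realType.

Definition eqmod1 (x y : R) : bool := x - y \is a Num.int.

Lemma eqmod1_refl : reflexive eqmod1.
Proof. by move=> x; rewrite /eqmod1 subrr rpred0. Qed.

Lemma eqmod1_sym : symmetric eqmod1.
Proof. by move=> x y; rewrite /eqmod1 -opprB rpredN. Qed.

Lemma eqmod1_trans : transitive eqmod1.
Proof.
by move=> y x z xy yz; rewrite /eqmod1 -(subrK y x) -addrA; exact: rpredD.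
Qed.

Canonical eqmod1_equiv :=
  EquivRel eqmod1 eqmod1_refl eqmod1_sym eqmod1_trans.

Definition circle := quotient_topology {eq_quot eqmod1}.
HB.instance Definition _ := Topological.on circle.

Definition circle_proj (t : R) : circle := \pi_({eq_quot eqmod1}) t.

Definition circle_dist (x y : circle) : R :=
  inf [set d | exists s t : R,
    [/\ circle_proj s = x, circle_proj t = y & d = `|s - t|] ].

Definition circle_lebesgue (A : set circle) : \bar R :=
  lebesgue_measure (`[0, 1[%classic `&` circle_proj @^-1` A).

Definition circle_lift (f : circle -> circle) (F : R -> R) : Prop :=
  forall t, f (circle_proj t) = circle_proj (F t).

Definition orientation_preserving (f : circle -> circle) : Prop :=
  exists F : R -> R,
    [/\ continuous F, {homo F : s t / s < t} & circle_lift f F].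

Definition homeo_with_inverse (f g : circle -> circle) : Prop :=
  [/\ cancel f g, cancel g f, continuous f & continuous g].

Definition circle_lipschitz (f : circle -> circle) : Prop :=
  exists k : R, forall x y, circle_dist (f x) (f y) <= k * circle_dist x y.

Definition bilipschitz_homeo (f : circle -> circle) : Prop :=
  exists g, [/\ homeo_with_inverse f g, circle_lipschitz f
             & circle_lipschitz g].

(* For r = k + alpha with k the integer part: C^k, with uniformly alpha-Hoelder
   k-th derivative when alpha > 0. When k >= 1 the k-th derivative of a lift is
   1-periodic, so the uniform and the local Hoelder conditions agree. *)
Definition Cr_fun (r : R) (F : R -> R) : Prop :=
  let k := Num.truncn r in
  let alpha := r - k%:R in
  [/\ forall i : nat, (i < k)%N -> forall t : R, derivable (derive1n i F) t 1,
      continuous (derive1n k F)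
    & 0 < alpha -> exists C : R, forall s t : R,
        `|derive1n k F s - derive1n k F t| <= C * `|s - t| `^ alpha].

Definition Cr_circle_map (r : R) (f : circle -> circle) : Prop :=
  exists F : R -> R, circle_lift f F /\ Cr_fun r F.

Definition Cr_diffeo (r : R) (f : circle -> circle) : Prop :=
  exists g, [/\ homeo_with_inverse f g, Cr_circle_map r f
             & Cr_circle_map r g].

End circle.

Definition finitely_generated (G : groupType) : Prop :=
  exists s : seq G, forall H : {pred G},
    group_closed H -> {subset s <= H} -> forall g, g \in H.

Section actions.
Variables (R : realType) (G : groupType).
Implicit Type theta : G -> circle R -> circle R.

Definition is_left_action theta : Prop :=
  theta 1%g = id /\ forall g h, theta (g * h)%g = theta g \o theta h.

Definition Cr_action (r : R) theta : Prop :=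
  is_left_action theta /\
  forall g, Cr_diffeo r (theta g) /\ orientation_preserving (theta g).

Definition minimal_action theta : Prop :=
  forall x, dense (range (fun g => theta g x)).

Definition non_free_action theta : Prop :=
  exists g, theta g <> id /\ exists x, theta g x = x.

(* A ranges over the Borel sets: as a hypothesis this is implied by the same
   condition over all Lebesgue measurable sets. *)
Definition lebesgue_ergodic theta : Prop :=
  forall A : set (circle R), <<s open >> A ->
    (forall g, theta g @` A = A) ->
    circle_lebesgue A = 0%E \/ circle_lebesgue A = circle_lebesgue setT.

End actions.

(* Main.v *)
Require Import Defs.
From HB Require Import structures.
From mathcomp Require Import all_boot all_order all_algebra.
From mathcomp Require Import all_classical all_reals all_analysis.
From mathcomp Require Import measurable_realfun.
From mathcomp Require Import ring lra.

Set Implicit Arguments.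
Unset Strict Implicit.
Unset Printing Implicit Defensive.

Import Order.TTheory GRing.Theory Num.Theory.
Import numFieldNormedType.Exports.

Local Open Scope ring_scope.
Local Open Scope classical_set_scope.

(* Lift everything to R. Since the conjugacy [F] is bi-Lipschitz, the cocycle
   [A' / (B' o F)] over the group of matched lifts [(A, B)] is bounded, so by a
   Gottschalk-Hedlund argument it is the coboundary of a continuous function [U].
   The set of points where the upper right derivative of [F] exceeds [c U] is
   exactly invariant; ergodicity makes it null or conull, so [F - c W], with [W] a
   primitive of [U], is monotone for each [c > 0]. For the [c] that makes this function
   periodic it is constant, hence [F' = c U] is continuous.
   An element with a fixed point and minimality give a ping-pong pair; averaging
   over words of length n yields an element with a hyperbolic fixed point, already in
   class C^1. Near that point [ln F'] solves a contracting cohomological equation,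
   which bootstraps its regularity up to class C^(r-1); minimality spreads it, and
   the inverse is handled by exchanging the two actions. *)

(** * Local Hoelder regularity *)

(** Were [F] differentiable, the chain rule for [F o A = B o F] would give
    [A' / (B' o F) = F' / (F' o A)]; so [F'] is sought among the solutions [U] of that equation, and
    boundedness of the quotient is the trace left by the bi-Lipschitz hypothesis. The obstacle is
    that [F] is only Lipschitz and ergodicity only speaks of sets that are invariant at every point.
    Upper right derivatives settle both: they exist everywhere, and they transform exactly under the
    group because [U] solves its equation everywhere and not just almost everywhere. The second
    obstacle is that with C^1 generators distortion along a word is not bounded. Continuity of the
    derivatives still makes the error per letter a factor as close to 1 as desired, and this loses
    against the factor 1/2 that each letter gains on average. The hyperbolic point is indispensable
    for the bootstrap: the equation [ln F' = ln F' o A + ln A' - ln (B' o F)] has coefficient 1, so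
    only the contraction of [A] can force its solutions to be as smooth as the data. *)

Section local_estimates.
Variable R : realType.
Implicit Types (f g : R -> R) (x l : R).

Lemma near_distP (x : R) (P : R -> Prop) :
  (\forall y \near x, P y) <->
  exists2 d : R, 0 < d & forall y, `|y - x| < d -> P y.
Proof.
split=> [/nbhs_ballP[d /= d0 dP]|[d d0 dP]].
  by exists d => // y yx; apply: dP; rewrite /ball /= distrC.
by apply/nbhs_ballP; exists d => //= y; rewrite /ball /= distrC; exact: dP.
Qed.

Lemma continuous_distP f x : {for x, continuous f} <->
  forall e : R, 0 < e -> exists2 d : R, 0 < d &
    forall y, `|y - x| < d -> `|f y - f x| < e.
Proof.
split=> [fx e e0|H].
  move/cvgrPdist_lt : fx => /(_ _ e0)/near_distP[d d0 dP].
  by exists d => // y /dP; rewrite distrC.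
apply/cvgrPdist_lt => e /H[d d0 dP]; apply/near_distP; exists d => // y /dP.
by rewrite distrC.
Qed.

Lemma near_continuous f x (P : R -> Prop) : {for x, continuous f} ->
  (\forall y \near f x, P y) -> \forall y \near x, P (f y).
Proof.
move=> /continuous_distP cf /near_distP[e e0 eP].
by have [d d0 dP] := cf _ e0; apply/near_distP; exists d => // y /dP/eP.
Qed.

Lemma is_derive_distP f x l : is_derive x 1 f l <->
  forall e : R, 0 < e -> exists2 d : R, 0 < d &
    forall y, `|y - x| < d -> `|f y - f x - l * (y - x)| <= e * `|y - x|.
Proof.
have E (h : R) : h != 0 -> `|l - h^-1 *: (f (h *: 1 + x) - f x)| =
    `|f (h + x) - f x - l * h| / `|h|.
  move=> h0; rewrite -normfV -normrM distrC; congr (`| _ |).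
  by rewrite /GRing.scale /= mulr1; field.
split=> [[fx fl] e e0|H].
  have {fx fl} : (fun h => h^-1 *: ((f \o shift x) (h *: 1) - f x)) @ 0^' --> l.
    by rewrite -fl; exact: fx.
  move=> /cvgrPdist_le /(_ _ e0) /nbhs_ballP[d /= d0 dP].
  exists d => // y yd; have [->|yx] := eqVneq y x.
    by rewrite !subrr mulr0 subr0 normr0 mulr0.
  have h0 : y - x != 0 by rewrite subr_eq0.
  have := dP (y - x); rewrite /ball /= sub0r normrN => /(_ yd h0).
  by rewrite E // subrK ler_pdivrMr // normr_gt0.
have : (fun h => h^-1 *: ((f \o shift x) (h *: 1) - f x)) @ 0^' --> l.
  apply/cvgrPdist_le => e /H[d d0 dP].
  apply/nbhs_ballP; exists d => //= h; rewrite /ball /= sub0r normrN => hd h0.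
  rewrite E // ler_pdivrMr ?normr_gt0 //.
  by have := dP (h + x); rewrite addrK => /(_ hd).
move=> fl; split; first by apply/cvg_ex; exists l.
exact: cvg_lim fl.
Qed.

Lemma derivable_is_derive1 f x : derivable f x 1 -> is_derive x 1 f (derive1 f x).
Proof. by move=> fx; rewrite derive1E; exact: derivableP. Qed.

Lemma is_derive1_val f x l : is_derive x 1 f l -> derive1 f x = l.
Proof. by rewrite derive1E => fl; rewrite derive_val. Qed.

Lemma is_derive1_continuous f x l : is_derive x 1 f l -> {for x, continuous f}.
Proof. by case=> fx _; apply: differentiable_continuous; apply/derivable1_diffP. Qed.

Lemma near_eq_derive1 f g x : (\forall y \near x, f y = g y) ->
  \forall y \near x, derive1 f y = derive1 g y.
Proof.
move=> /near_join; apply: filterS => y fg.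
by rewrite !derive1E; exact: near_eq_derive fg.
Qed.

Lemma MVT_dist f (x d : R) (s t : R) :
  (forall y, `|y - x| < d -> derivable f y 1) -> `|s - x| < d -> `|t - x| < d ->
  exists c, [/\ `|c - x| < d, `|c - s| <= `|s - t|, `|c - t| <= `|s - t|
              & f s - f t = derive1 f c * (s - t)].
Proof.
move=> df.
have main u v : u < v -> `|u - x| < d -> `|v - x| < d ->
    exists c, [/\ u <= c, c <= v & f v - f u = derive1 f c * (v - u)].
  move=> uv ux vx.
  have H y : u <= y <= v -> `|y - x| < d.
    by move=> /andP[uy yv]; move: ux vx; rewrite !ltr_distl => /andP[? ?] /andP[? ?];
      apply/andP; split; lra.
  have [||c cuv E] := @MVT _ f (derive1 f) _ _ uv.
  - move=> y; rewrite in_itv /= => /andP[/ltW ? /ltW ?].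
    by apply/derivable_is_derive1/df/H/andP.
  - apply: derivable_within_continuous => y; rewrite in_itv /= => yuv.
    exact/df/H.
  - by move: cuv; rewrite in_itv /= => /andP[/ltW ? /ltW ?]; exists c.
move=> sx tx; have [st|ts|->] := ltgtP s t.
- have [c [sc ct E]] := main _ _ st sx tx; exists c; split.
  + by move: sx tx; rewrite !ltr_distl => /andP[? ?] /andP[? ?]; apply/andP; split; lra.
  + by rewrite ger0_norm ?subr_ge0 // ltr0_norm ?subr_lt0 //; lra.
  + by rewrite ler0_norm ?subr_le0 // ltr0_norm ?subr_lt0 //; lra.
  + by rewrite -opprB E -mulrN opprB.
- have [c [sc ct E]] := main _ _ ts tx sx; exists c; split => //.
  + by move: sx tx; rewrite !ltr_distl => /andP[? ?] /andP[? ?]; apply/andP; split; lra.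
  + by rewrite ler0_norm ?subr_le0 // gtr0_norm ?subr_gt0 //; lra.
  + by rewrite ger0_norm ?subr_ge0 // gtr0_norm ?subr_gt0 //; lra.
- by exists t; rewrite !subrr mulr0 normr0.
Qed.

(** By the mean value theorem, continuity of the derivative makes the linear approximation uniform
    over two moving points; limits of slopes over pairs [(s, t)] need it in this form. *)
Lemma strict_derive f x : (\forall y \near x, derivable f y 1) ->
  {for x, continuous (derive1 f)} ->
  forall e : R, 0 < e -> exists2 d : R, 0 < d &
    forall s t, `|s - x| < d -> `|t - x| < d ->
      `|f s - f t - derive1 f x * (s - t)| <= e * `|s - t|.
Proof.
move=> /near_distP[d1 d10 df] /continuous_distP cf e e0.
have [d2 d20 d2P] := cf _ e0.
exists (Num.min d1 d2) => [|s t]; first by rewrite lt_min d10.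
rewrite !lt_min => /andP[s1 s2] /andP[t1 t2].
have [|||c [cx _ _ ->]] := @MVT_dist f x (Num.min d1 d2) s t.
- by move=> y; rewrite lt_min => /andP[/df].
- by rewrite lt_min s1.
- by rewrite lt_min t1.
rewrite -mulrBl normrM ler_wpM2r // ltW // d2P //.
by move: cx; rewrite lt_min => /andP[].
Qed.

Lemma C1_locally_lipschitz f x : (\forall y \near x, derivable f y 1) ->
  {for x, continuous (derive1 f)} ->
  exists C d : R, [/\ 0 <= C, 0 < d & forall s t, `|s - x| < d -> `|t - x| < d ->
      `|f s - f t| <= C * `|s - t|].
Proof.
move=> df cf; have [d d0 dP] := strict_derive df cf ltr01.
exists (1 + `|derive1 f x|), d; split => // s t sx tx.
rewrite -[X in `|X|](subrK (derive1 f x * (s - t))) (le_trans (ler_normD _ _)) //.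
by rewrite mulrDl lerD ?dP // normrM.
Qed.

End local_estimates.

(** * Local C^(n + alpha) classes and their stability under the usual operations *)

Section local_regularity.
Variables (R : realType) (al : R).
Hypothesis al01 : 0 <= al <= 1.
Implicit Types (f g : R -> R) (x : R).

Definition lipschitz_at f x := exists C d : R, [/\ 0 <= C, 0 < d &
  forall s t, `|s - x| < d -> `|t - x| < d -> `|f s - f t| <= C * `|s - t|].

Definition holder_at f x := exists C d : R, [/\ 0 <= C, 0 < d &
  forall s t, `|s - x| < d -> `|t - x| < d ->
    `|f s - f t| <= C * `|s - t| `^ al].

(* [Cr_at n f x]: f is C^(n + al) near x; for [al = 0] the Hoelder condition
   only says that the last derivative is locally bounded. *)
Fixpoint Cr_at n f x : Prop :=
  if n is m.+1 then (\forall y \near x, derivable f y 1) /\ Cr_at m (derive1 f) x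
  else (\forall y \near x, {for y, continuous f}) /\ holder_at f x.

Lemma ler_dist_powR (u : R) : 0 <= u -> u <= 1 -> u <= u `^ al.
Proof.
move=> u0 u1; have /andP[al0 al1] := al01.
have [->|un0] := eqVneq u 0; first exact: powR_ge0.
rewrite -[X in X <= _]powRr1 // ger_powR //.
by rewrite lt_neqAle eq_sym un0 u0 u1.
Qed.

Lemma holder_at_near f x : holder_at f x -> \forall y \near x, holder_at f y.
Proof.
move=> [C [d [C0 d0 H]]]; apply/near_distP; exists (d / 2); first lra.
move=> y yx; exists C, (d / 2); split => //; first lra.
have K s : `|s - y| < d / 2 -> `|s - x| < d.
  by move=> sy; rewrite (le_lt_trans (ler_distD y _ _)) // (splitr d) ltrD.
by move=> s t sy ty; apply: H; exact: K.
Qed.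

Lemma Cr_at_near n f x : Cr_at n f x -> \forall y \near x, Cr_at n f y.
Proof.
elim: n f => [|n IH] f /= [fx].
  move/holder_at_near => h; move/near_join : fx => fx.
  by apply: filterS2 fx h => y ? ?; split.
by move/IH => h; move/near_join : fx => fx; apply: filterS2 fx h => y; split.
Qed.

Lemma near_eq_continuous f g x : (\forall y \near x, f y = g y) ->
  {for x, continuous f} -> {for x, continuous g}.
Proof.
move=> /near_distP[d d0 fg] /continuous_distP cf; apply/continuous_distP => e.
move=> /cf[d' d'0 fe]; exists (Num.min d d') => [|y]; first by rewrite lt_min d0.
by rewrite lt_min => /andP[yd yd']; rewrite -!fg ?subrr ?normr0 // fe.
Qed.

Lemma Cr_at_eq n f g x : (\forall y \near x, f y = g y) ->
  Cr_at n f x -> Cr_at n g x.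
Proof.
elim: n f g => [|n IH] f g fg /= [fx].
  move=> [C [d [C0 d0 H]]]; split.
    move/near_join : (fg) => fg'; apply: filterS2 fx fg' => y fy fgy.
    exact: near_eq_continuous fgy fy.
  have [e e0 fge] := (near_distP _ _).1 fg.
  exists C, (Num.min d e); split => //; first by rewrite lt_min d0.
  by move=> s t; rewrite !lt_min => /andP[sd se] /andP[td te]; rewrite -!fge // H.
move=> h; split; last by apply: IH h; exact: near_eq_derive1.
move/near_join : (fg) => fg'; apply: filterS2 fx fg' => y fy fgy.
exact: near_eq_derivable fy.
Qed.

Lemma Cr_at0_C1 f x : (\forall y \near x, derivable f y 1) ->
  (\forall y \near x, {for y, continuous (derive1 f)}) -> Cr_at 0 f x.
Proof.
move=> df cf; split.
  by apply: filterS df => y /derivable_is_derive1 /is_derive1_continuous.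
have [C [d [C0 d0 H]]] := C1_locally_lipschitz df (nbhs_singleton cf).
(* A radius of at most 1/2 keeps [|s - t|] below 1, where a number is at most its power with
   exponent [al]. *)
exists C, (Num.min d (1/2)); split => //; first by rewrite lt_min d0; lra.
move=> s t; rewrite !lt_min => /andP[sd s2] /andP[td t2].
rewrite (le_trans (H _ _ sd td)) // ler_wpM2l // ler_dist_powR //.
rewrite (le_trans (ler_distD x _ _)) // [`|x - t|]distrC; lra.
Qed.

Lemma Cr_at_near_continuous n f x : Cr_at n f x ->
  \forall y \near x, {for y, continuous f}.
Proof.
case: n => [[]//|n [df _]].
by apply: filterS df => y /derivable_is_derive1 /is_derive1_continuous.
Qed.

Lemma Cr_at_continuous n f x : Cr_at n f x -> {for x, continuous f}.
Proof. by move=> /Cr_at_near_continuous/nbhs_singleton. Qed.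

Lemma Cr_at_pred n f x : Cr_at n.+1 f x -> Cr_at n f x.
Proof.
elim: n f => [|n IH] f [df cf]; last by split => //; exact: IH.
apply: Cr_at0_C1; first exact: df.
exact: (@Cr_at_near_continuous 0).
Qed.

Lemma Cr_at_le m n f x : (m <= n)%N -> Cr_at n f x -> Cr_at m f x.
Proof.
by move=> /subnK <-; elim: (n - m)%N => // k IH h; apply: IH; exact: Cr_at_pred.
Qed.

Lemma Cr_at_lipschitz n f x : Cr_at n.+1 f x -> lipschitz_at f x.
Proof.
by move=> [df cf]; apply: C1_locally_lipschitz => //; exact: Cr_at_continuous cf.
Qed.

Lemma Cr_atS_intro n f f' x : (\forall y \near x, is_derive (y : R) 1 f (f' y)) ->
  Cr_at n f' x -> Cr_at n.+1 f x.
Proof.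
move=> df cf; split; first by apply: filterS df => y [].
by apply: Cr_at_eq cf; apply: filterS df => y /is_derive1_val.
Qed.

Lemma Cr_at_cst n c x : Cr_at n (fun=> c) x.
Proof.
elim: n c => [|n IH] c.
  apply: Cr_at0_C1; first by apply: filterE => y; exact: derivable_cst.
  apply: filterE => y; have -> : derive1 (fun=> c : R) = (fun=> 0).
    by apply/funext => z; exact: derive1_cst.
  exact: cst_continuous.
apply: Cr_atS_intro (IH 0); apply: filterE => y; exact: is_derive_cst.
Qed.

Lemma Cr_at_id n x : Cr_at n id x.
Proof.
case: n => [|n]; last first.
  by apply: Cr_atS_intro (Cr_at_cst n 1 x); apply: filterE => y; exact: is_derive_id.
apply: (@Cr_at_pred 0); apply: Cr_atS_intro (Cr_at_cst 0 1 x).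
by apply: filterE => y; exact: is_derive_id.
Qed.

Lemma Cr_atD n f g x : Cr_at n f x -> Cr_at n g x ->
  Cr_at n (fun t => f t + g t) x.
Proof.
elim: n f g => [|n IH] f g [fx hf] [gx hg].
  split; first by apply: filterS2 fx gx => y; exact: cvgD.
  move: hf hg => [C [d [C0 d0 H]]] [C' [d' [C'0 d'0 H']]].
  exists (C + C'), (Num.min d d'); split; rewrite ?addr_ge0 ?lt_min ?d0 //.
  move=> s t; rewrite !lt_min => /andP[? ?] /andP[? ?].
  rewrite opprD addrACA mulrDl (le_trans (ler_normD _ _)) //.
  by rewrite lerD // ?H ?H'.
apply: Cr_atS_intro (IH _ _ hf hg); apply: filterS2 fx gx => y fy gy.
by apply: is_deriveD; exact: derivable_is_derive1.
Qed.

Lemma Cr_atM n f g x : Cr_at n f x -> Cr_at n g x ->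
  Cr_at n (fun t => f t * g t) x.
Proof.
elim: n f g => [|n IH] f g fgx ggx; last first.
  have [fx hf] := fgx; have [gx hg] := ggx.
  have := Cr_atD (IH _ _ (Cr_at_pred fgx) hg) (IH _ _ (Cr_at_pred ggx) hf).
  apply: Cr_atS_intro; apply: filterS2 fx gx => y fy gy.
  by apply: is_deriveM; exact: derivable_is_derive1.
move: fgx ggx => [fx hf] [gx hg].
split; first by apply: filterS2 fx gx => y; exact: cvgM.
move: hf hg => [C [d [C0 d0 H]]] [C' [d' [C'0 d'0 H']]].
have bnd (h : R -> R) : {for x, continuous h} ->
    exists2 e, 0 < e & forall y, `|y - x| < e -> `|h y| <= 1 + `|h x|.
  move=> /continuous_distP ch; have [e e0 eP] := ch _ ltr01; exists e => // y /eP hy.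
  rewrite -[h y](subrK (h x)) (le_trans (ler_normD _ _)) // lerD2r.
  exact: ltW.
have [e1 e10 b1] := bnd _ (nbhs_singleton fx).
have [e2 e20 b2] := bnd _ (nbhs_singleton gx).
set M1 := 1 + _ in b1; set M2 := 1 + _ in b2.
have M10 : 0 <= M1 by rewrite addr_ge0.
have M20 : 0 <= M2 by rewrite addr_ge0.
exists (M1 * C' + C * M2), (Num.min (Num.min d d') (Num.min e1 e2)); split.
- by rewrite addr_ge0 // mulr_ge0.
- by rewrite !lt_min d0 d'0 e10.
move=> s t; rewrite !lt_min => /andP[/andP[s1 s2] /andP[s3 s4]].
move=> /andP[/andP[t1 t2] /andP[t3 t4]].
have -> : f s * g s - f t * g t = f s * (g s - g t) + (f s - f t) * g t by ring.
rewrite (le_trans (ler_normD _ _)) // !normrM mulrDl lerD //.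
  by rewrite -mulrA ler_pM // ?b1 // H'.
by rewrite mulrAC ler_pM // ?b2 // H.
Qed.

Lemma Cr_atN n f x : Cr_at n f x -> Cr_at n (fun t => - f t) x.
Proof.
move=> h; have := Cr_atM (Cr_at_cst n (-1) x) h; apply: Cr_at_eq.
by apply: filterE => y; rewrite mulN1r.
Qed.

Lemma Cr_atB n f g x : Cr_at n f x -> Cr_at n g x ->
  Cr_at n (fun t => f t - g t) x.
Proof. by move=> hf hg; apply: Cr_atD => //; exact: Cr_atN. Qed.

Lemma lipschitz_at_continuous f x : lipschitz_at f x -> {for x, continuous f}.
Proof.
move=> [C [d [C0 d0 H]]]; apply/continuous_distP => e e0.
have C1 : 0 < C + 1 by lra.
exists (Num.min d (e / (C + 1))); first by rewrite lt_min d0 divr_gt0.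
move=> y; rewrite lt_min ltr_pdivlMr // => /andP[yd ye].
rewrite (le_lt_trans (H _ _ yd _)) ?subrr ?normr0 // (le_lt_trans _ ye) //.
by rewrite mulrC ler_wpM2l //; lra.
Qed.

(* A composition of Hoelder functions loses regularity, hence the Lipschitz
   hypothesis, which matters only for [n = 0]. *)
Lemma Cr_at_comp n f g x : Cr_at n f (g x) -> Cr_at n g x -> lipschitz_at g x ->
  Cr_at n (f \o g) x.
Proof.
move=> hf hg lg; have cg := lipschitz_at_continuous lg.
elim: n f g hf hg lg cg => [|n IH] f g hf hg lg cg.
  have [fx hf'] := hf; have [gx _] := hg; split.
    have fgx : \forall y \near x, {for g y, continuous f} by exact: near_continuous cg fx.
    by apply: filterS2 gx fgx => y; exact: continuous_comp.
  move: hf' lg => [C [d [C0 d0 H]]] [C' [d' [C'0 d'0 H']]].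
  have [e e0 eP] := (continuous_distP _ _).1 cg _ d0.
  have /andP[al0 al1] := al01.
  exists (C * C' `^ al), (Num.min d' e); split.
  - by rewrite mulr_ge0 // powR_ge0.
  - by rewrite lt_min d'0.
  move=> s t; rewrite !lt_min => /andP[s1 s2] /andP[t1 t2] /=.
  rewrite (le_trans (H _ _ _ _)) ?eP // -mulrA ler_wpM2l // -powRM //.
  by rewrite ge0_ler_powR ?nnegrE ?mulr_ge0 // H'.
have [fx hf'] := hf; have [gx hg'] := hg.
have := Cr_atM (IH _ _ hf' (Cr_at_pred hg) lg cg) hg'.
apply: Cr_atS_intro.
have fgx : \forall y \near x, derivable f (g y) 1 by exact: near_continuous cg fx.
apply: filterS2 gx fgx => y gy fy.
exact: (is_derive1_comp (derivable_is_derive1 fy) (derivable_is_derive1 gy)).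
Qed.

(** One extra derivative on the outer map replaces the Lipschitz condition on the inner one: for
    [n = 0] the outer map is then Lipschitz and preserves the Hoelder exponent, for larger [n] the
    inner map is itself C^1. *)
Lemma Cr_at_comp_smooth n f g x : Cr_at n.+1 f (g x) -> Cr_at n g x ->
  Cr_at n (f \o g) x.
Proof.
case: n => [|n] hf hg; last first.
  by apply: Cr_at_comp => //; [exact: Cr_at_pred | exact: Cr_at_lipschitz hg].
have [C [d [C0 d0 H]]] := Cr_at_lipschitz hf.
have cg : {for x, continuous g} by exact: Cr_at_continuous hg.
have [gx [C' [d' [C'0 d'0 H']]]] := hg; split.
  have fgx : \forall y \near x, {for g y, continuous f}.
    exact: near_continuous cg (Cr_at_near_continuous hf).
  by apply: filterS2 gx fgx => y; exact: continuous_comp.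
have [e e0 eP] := (continuous_distP _ _).1 cg _ d0.
exists (C * C'), (Num.min d' e); split; rewrite ?mulr_ge0 ?lt_min ?d'0 //.
move=> s t; rewrite !lt_min => /andP[s1 s2] /andP[t1 t2] /=.
by rewrite (le_trans (H _ _ _ _)) ?eP // -mulrA ler_wpM2l // H'.
Qed.

Lemma Cr_at_expR n x : Cr_at n expR x.
Proof.
have E (y : R) : is_derive y 1 expR (expR y : R) by exact: is_derive_expR.
elim: n => [|n IH]; last by apply: Cr_atS_intro IH; exact: filterE.
apply: Cr_at0_C1; first by apply: filterE => y; case: (E y).
apply: filterE => y; have -> : derive1 expR = expR :> (R -> R).
  by apply/funext => z; exact: is_derive1_val.
exact: continuous_expR.
Qed.

Lemma near_neq0 x : x != 0 -> \forall y \near x, y != 0.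
Proof.
move=> x0; apply/near_distP; exists `|x|; first by rewrite normr_gt0.
by move=> y; apply: contraTneq => ->; rewrite sub0r normrN ltxx.
Qed.

Lemma Cr_at_inv n x : x != 0 -> Cr_at n (@GRing.inv R) x.
Proof.
have E (y : R) : y != 0 -> is_derive y 1 (@GRing.inv R) (- (y^-1 * y^-1)).
  move=> y0; have := @is_deriveV R id y 1 1 y0 _.
  by rewrite /GRing.scale /= mulr1 expr2 invfM; apply; exact: is_derive_id.
elim: n => [|n IH] x0.
  apply: Cr_at0_C1.
    by apply: filterS (near_neq0 x0) => y /E[].
  have : \forall y \near x, \forall z \near y, z != 0.
    by apply: near_join; exact: near_neq0.
  apply: filterS => y y0.
  have : {for y, continuous (fun t : R => - (t^-1 * t^-1))}.
    by apply: cvgN; apply: cvgM; apply: cvgV => //; exact: nbhs_singleton y0.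
  by apply: near_eq_continuous; apply: filterS y0 => z /E/is_derive1_val.
apply: Cr_atS_intro (Cr_atN (Cr_atM (IH x0) (IH x0))).
by apply: filterS (near_neq0 x0) => y /E.
Qed.

Lemma near_gt0 x : 0 < x -> \forall y \near x, 0 < y.
Proof.
move=> x0; apply/near_distP; exists x => // y; rewrite ltr_distl => /andP[]; lra.
Qed.

Lemma Cr_at_ln n x : 0 < x -> Cr_at n (@ln R) x.
Proof.
move=> x0; apply: Cr_at_pred; have := @Cr_at_inv n x; rewrite gt_eqF // => /(_ isT).
apply: Cr_atS_intro; apply: filterS (near_gt0 x0) => y; exact: is_derive1_ln.
Qed.

End local_regularity.

(** * Contracting cohomological equations *)

Lemma geometric_small (R : realType) (M z e : R) : 0 <= z < 1 -> 0 < e ->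
  exists n, M * z ^+ n < e.
Proof.
move=> /andP[z0 z1] e0.
have /cvgrPdist_lt /(_ _ e0)[N _ /(_ N (leqnn N))] := @cvg_geometric R M z
  ltac:(by rewrite ger0_norm).
by rewrite sub0r normrN /geometric /= => /(le_lt_trans (ler_norm _)); exists N.
Qed.

Section contraction.
Variable R : realType.
Implicit Types (A y a b f : R -> R) (p d rho be C L x l : R).

Lemma contraction_holder A y p d rho be C : 0 < d -> 0 <= rho < 1 -> A p = p ->
  0 < be -> 0 <= C ->
  (forall s t, `|s - p| < d -> `|t - p| < d -> `|A s - A t| <= rho * `|s - t|) ->
  {for p, continuous y} ->
  (forall s t, `|s - p| < d -> `|t - p| < d ->
     `|y s - y t| <= `|y (A s) - y (A t)| + C * `|s - t| `^ be) ->
  forall s t, `|s - p| < d -> `|t - p| < d ->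
     `|y s - y t| <= C / (1 - rho `^ be) * `|s - t| `^ be.
Proof.
move=> d0 /andP[r0 r1] Ap be0 C0 ctr cy H.
have rb : rho `^ be < 1.
  have : rho `^ be < 1 `^ be by apply: gt0_ltr_powR; rewrite ?nnegrE.
  by rewrite powR1.
have rb0 : 0 < 1 - rho `^ be by lra.
set D := C / _.
have D0 : 0 <= D by rewrite divr_ge0 // ltW.
have DE : C + rho `^ be * D = D by rewrite /D; field; lra.
have pd : `|p - p| < d by rewrite subrr normr0.
have ball_A s : `|s - p| < d -> `|A s - p| < d.
  move=> sd; rewrite -[X in _ - X]Ap (le_lt_trans (ctr _ _ sd pd)) //.
  by rewrite (le_lt_trans _ sd) // ler_piMl // ltW.
have iterD n s : `|s - p| < d -> `|iter n A s - p| <= d * rho ^+ n.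
  elim: n s => [|n IH] s sd; first by rewrite expr0 mulr1 ltW.
  have iterd : `|iter n A s - p| < d.
    by elim: n {IH} => // n IHn; rewrite iterS ball_A.
  rewrite iterS -[X in _ - X]Ap (le_trans (ctr _ _ iterd pd)) //.
  by rewrite exprS mulrCA ler_wpM2l // IH.
have step n s t : `|s - p| < d -> `|t - p| < d ->
    `|y s - y t| <= `|y (iter n A s) - y (iter n A t)| + D * `|s - t| `^ be.
  elim: n s t => [|n IH] s t sd td; first by rewrite lerDl mulr_ge0 // powR_ge0.
  have K : D * `|A s - A t| `^ be <= D * (rho `^ be * `|s - t| `^ be).
    rewrite ler_wpM2l // -powRM // ge0_ler_powR ?nnegrE ?mulr_ge0 ?ctr // ltW //.
  have E : C * `|s - t| `^ be + rho `^ be * D * `|s - t| `^ be = D * `|s - t| `^ be.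
    by rewrite -mulrDl DE.
  have H1 := H _ _ sd td; have H2 := IH _ _ (ball_A _ sd) (ball_A _ td).
  rewrite !iterSr; lra.
move=> s t sd td; apply/ler_addgt0Pr => e e0.
have e2 : 0 < e / 2 by lra.
have [g g0 gP] := (continuous_distP _ _).1 cy _ e2.
have [n nP] := @geometric_small R d rho g ltac:(by rewrite r0) g0.
rewrite (le_trans (step n _ _ sd td)) // addrC lerD2l.
rewrite (le_trans (ler_distD (y p) _ _)) // [`|y p - _|]distrC (splitr e).
by rewrite lerD // ltW // gP // (le_lt_trans _ nP) // iterD.
Qed.

(** Convergence of slopes along this filter is strict differentiability at [x]. Pairs close to
    [(z, z)] for [z] near [x] are included, which is what makes the derivative continuous at [x]. *)
Definition offdiag x : set_system (R * R) :=
  within [set u | u.1 != u.2] (nbhs (x, x)).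

Lemma offdiagP x (E : R * R -> Prop) : offdiag x E <->
  exists2 d, 0 < d & forall s t, `|s - x| < d -> `|t - x| < d -> s != t -> E (s, t).
Proof.
split=> [|[d d0 dE]].
  move=> /nbhs_ballP[d /= d0 dE]; exists d => // s t sd td st.
  by apply: (dE (s, t)) => //; split; rewrite /ball /= distrC.
apply/nbhs_ballP; exists d => //= -[s t] [/= sd td] /= st.
by apply: dE; rewrite 1?distrC.
Qed.

#[local] Instance offdiag_filter x : ProperFilter (offdiag x).
Proof.
split; last exact: within_filter.
move=> /offdiagP[d d0 /(_ x (x + d / 2))]; apply.
- by rewrite subrr normr0.
- rewrite addrAC subrr add0r gtr0_norm; lra.
- by apply/eqP => h; lra.
Qed.

Definition slope f (u : R * R) := (f u.1 - f u.2) / (u.1 - u.2).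

Lemma cvg_slope f x l :
  (forall e : R, 0 < e -> exists2 d : R, 0 < d &
    forall s t, `|s - x| < d -> `|t - x| < d ->
      `|f s - f t - l * (s - t)| <= e * `|s - t|) ->
  slope f @ offdiag x --> l.
Proof.
move=> H; apply/cvgrPdist_le => e /H[d d0 dP].
apply/offdiagP; exists d => // s t sd td st /=.
have st0 : s - t != 0 by rewrite subr_eq0.
rewrite distrC /slope /= -[l](mulfK st0) -mulrBl normrM normfV.
by rewrite ler_pdivrMr ?normr_gt0 // dP.
Qed.

Lemma cvg_fst_offdiag f x : {for x, continuous f} -> f u.1 @[u --> offdiag x] --> f x.
Proof.
move=> /continuous_distP cf; apply/cvgrPdist_lt => e /cf[d d0 dP].
by apply/offdiagP; exists d => // s t sd td st /=; rewrite distrC dP.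
Qed.

Lemma cvg_snd_offdiag f x : {for x, continuous f} -> f u.2 @[u --> offdiag x] --> f x.
Proof.
move=> /continuous_distP cf; apply/cvgrPdist_lt => e /cf[d d0 dP].
by apply/offdiagP; exists d => // s t sd td st /=; rewrite distrC dP.
Qed.

Lemma is_derive_slope f x l : slope f @ offdiag x --> l -> is_derive x 1 f l.
Proof.
move=> /cvgrPdist_le H; apply/is_derive_distP => e /H /offdiagP[d d0 dP].
exists d => // y yx; have [->|nyx] := eqVneq y x.
  by rewrite !subrr mulr0 subr0 normr0 mulr0.
have yx0 : y - x != 0 by rewrite subr_eq0.
have := dP y x yx; rewrite subrr normr0 => /(_ d0 nyx); rewrite distrC /slope /=.
have -> : (f y - f x) / (y - x) - l = (f y - f x - l * (y - x)) / (y - x) by field.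
rewrite normrM normfV.
by rewrite ler_pdivrMr ?normr_gt0.
Qed.

(* The slopes of y satisfy an equation contracting by [rho], so the oscillation
   of the slopes at any point of the diagonal vanishes. *)
Lemma derive_cohomology A y a b p d rho L : 0 <= rho < 1 -> 0 <= L -> 0 < d ->
  A p = p ->
  (forall s t, `|s - p| < d -> `|t - p| < d -> `|A s - A t| <= rho * `|s - t|) ->
  (forall s t, `|s - p| < d -> `|t - p| < d -> A s = A t -> s = t) ->
  (forall s, `|s - p| < d -> `|a s| <= 1) ->
  (forall s, `|s - p| < d -> y s = a s * y (A s) + b s) ->
  (forall s t, `|s - p| < d -> `|t - p| < d -> `|y s - y t| <= L * `|s - t|) ->
  (forall f, [\/ f = A, f = a | f = b] -> forall x, `|x - p| < d ->
     (\forall z \near x, derivable f z 1) /\ {for x, continuous (derive1 f)}) ->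
  forall x, `|x - p| < d -> derivable y x 1 /\ {for x, continuous (derive1 y)}.
Proof.
move=> /andP[r0 r1] L0 d0 Ap ctr inj a1 eqy lip C1.
have pd : `|p - p| < d by rewrite subrr normr0.
have ball_A s : `|s - p| < d -> `|A s - p| < d.
  move=> sd; rewrite -[X in _ - X]Ap (le_lt_trans (ctr _ _ sd pd)) //.
  by rewrite (le_lt_trans _ sd) // ler_piMl // ltW.
have cvg_sl f : [\/ f = A, f = a | f = b] -> forall x, `|x - p| < d ->
    slope f @ offdiag x --> derive1 f x.
  move=> hf x xd; apply: cvg_slope; have [? ?] := C1 f hf x xd.
  exact: strict_derive.
have cont f : [\/ f = A, f = a | f = b] -> forall x, `|x - p| < d -> {for x, continuous f}.
  move=> hf x xd; have [df _] := C1 f hf x xd.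
  by apply: is_derive1_continuous; apply: derivable_is_derive1; exact: nbhs_singleton df.
have conty x : `|x - p| < d -> {for x, continuous y}.
  move=> xd; apply: lipschitz_at_continuous; exists L, (d - `|x - p|).
  split => //; first by rewrite subr_gt0.
  by move=> s t sx tx; apply: lip; rewrite (le_lt_trans (ler_distD x _ _)) // -ltrBrDr.
have nearin x : `|x - p| < d -> offdiag x [set u | `|u.1 - p| < d /\ `|u.2 - p| < d].
  move=> xd; apply/offdiagP; exists (d - `|x - p|); first by rewrite subr_gt0.
  by move=> s t sx tx _; split; rewrite (le_lt_trans (ler_distD x _ _)) // -ltrBrDr.
(* Subtracting the equation at two points gives an affine recursion for the slopes with coefficient
   [k] and inhomogeneity [r]. Injectivity of [A] keeps the image pair off the diagonal. *)
pose k u := a u.1 * slope A u.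
pose r u := slope a u * y (A u.2) + slope b u.
pose AA (u : R * R) := (A u.1, A u.2).
have slopeE u : `|u.1 - p| < d -> `|u.2 - p| < d -> u.1 != u.2 ->
    slope y u = k u * slope y (AA u) + r u.
  move=> ud vd uv; have uv0 : u.1 - u.2 != 0 by rewrite subr_eq0.
  have AA0 : A u.1 - A u.2 != 0.
    by rewrite subr_eq0; apply: contra_neq uv; exact: inj.
  rewrite /slope /r /k /slope /AA /= (eqy _ ud) (eqy _ vd).
  by field; rewrite uv0 AA0.
have kle u : `|u.1 - p| < d -> `|u.2 - p| < d -> u.1 != u.2 -> `|k u| <= rho.
  move=> ud vd uv; rewrite normrM -[rho]mul1r ler_pM // ?a1 //.
  by rewrite normrM normfV ler_pdivrMr ?normr_gt0 ?subr_eq0 // ctr.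
have sle u : `|u.1 - p| < d -> `|u.2 - p| < d -> u.1 != u.2 -> `|slope y u| <= L.
  by move=> ud vd uv; rewrite normrM normfV ler_pdivrMr ?normr_gt0 ?subr_eq0 // lip.
(* Passing from [A x] back to [x] multiplies the oscillation by [rho] and adds an error [e];
   [e / (1 - rho)] is the fixed point of this operation, and [2 * L] bounds the oscillation at the
   start. *)
have osc e : 0 < e -> forall n x, `|x - p| < d ->
    exists2 E, offdiag x E & forall u v, E u -> E v ->
      `|slope y u - slope y v| <= 2 * L * rho ^+ n + e / (1 - rho).
  move=> e0; elim=> [|n IH] x xd.
    exists [set u | `|slope y u| <= L].
      have [c c0 cP] := (offdiagP _ _).1 (nearin x xd).
      by apply/offdiagP; exists c => // s t sc tc st; have [] := cP s t sc tc st => *; exact: sle.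
    move=> u v /= uL vL; rewrite expr0 mulr1 (le_trans (ler_normB _ _)) //.
    have : 0 <= e / (1 - rho) by rewrite divr_ge0 //; lra.
    by lra.
  have [E FE HE] := IH _ (ball_A _ xd).
  have ck : k @ offdiag x --> a x * derive1 A x.
    apply: cvgM; first by apply: (@cvg_fst_offdiag a); apply: cont => //; exact: Or32.
    by apply: cvg_sl => //; exact: Or31.
  have cr : r @ offdiag x --> derive1 a x * y (A x) + derive1 b x.
    apply: cvgD; last by apply: cvg_sl => //; exact: Or33.
    apply: cvgM; first by apply: cvg_sl => //; exact: Or32.
    apply: (@cvg_snd_offdiag (y \o A)); apply: continuous_comp.
      by apply: cont => //; exact: Or31.
    by apply: conty; exact: ball_A.
  (* Chosen so that [2 * e1], the variation of [k], times a slope bounded by [L + 1] is [e / 2]; the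
     1 avoids a zero denominator. *)
  set e1 := e / (4 * (L + 1)).
  have e10 : 0 < e1 by rewrite divr_gt0 // mulr_gt0 //; lra.
  have e4 : 0 < e / 4 by lra.
  move/cvgrPdist_le : ck => /(_ _ e10) ck; move/cvgrPdist_le : cr => /(_ _ e4) cr.
  have FA : offdiag x (fun u => E (AA u)).
    have [c c0 cE] := (offdiagP _ _).1 FE.
    have cA : {for x, continuous A} by apply: cont => //; exact: Or31.
    have [c' c'0 c'P] := (continuous_distP _ _).1 cA _ c0.
    have [c'' c''0 c''P] := (offdiagP _ _).1 (nearin x xd).
    apply/offdiagP; exists (Num.min c' c''); first by rewrite lt_min c'0.
    move=> s t; rewrite !lt_min => /andP[sc sc'] /andP[tc tc'] st; apply: cE.
    - exact: c'P.
    - exact: c'P.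
    - have [ud vd] := c''P s t sc' tc' st.
      by apply: contra_neq st; exact: inj.
  have ne : offdiag x [set u | u.1 != u.2] by apply/offdiagP; exists 1.
  exists [set u | [/\ `|a x * derive1 A x - k u| <= e1,
       `|derive1 a x * y (A x) + derive1 b x - r u| <= e / 4, E (AA u),
       (`|u.1 - p| < d /\ `|u.2 - p| < d) & u.1 != u.2]].
    apply: filterS2 (filterI ck cr) (filterI (filterI FA (nearin x xd)) ne).
    by move=> u [? ?] [[? ?] ?]; split.
  move=> u v [ku ru Eu [u1 u2] un] [kv rv Ev [v1 v2] vn].
  rewrite (slopeE _ u1 u2 un) (slopeE _ v1 v2 vn).
  have AAn w : `|w.1 - p| < d -> `|w.2 - p| < d -> w.1 != w.2 -> (AA w).1 != (AA w).2.
    by move=> w1 w2; apply: contra_neq; exact: inj.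
  have sv : `|slope y (AA v)| <= L by apply: sle => /=; rewrite ?ball_A ?AAn.
  have -> : k u * slope y (AA u) + r u - (k v * slope y (AA v) + r v) =
    k u * (slope y (AA u) - slope y (AA v)) + ((k u - k v) * slope y (AA v) +
     (r u - r v)) by ring.
  have B1 : `|k u * (slope y (AA u) - slope y (AA v))| <=
      rho * (2 * L * rho ^+ n + e / (1 - rho)).
    by rewrite normrM ler_pM // ?kle // HE.
  have B2 : `|(k u - k v) * slope y (AA v)| <= e / 2.
    have kuv : `|k u - k v| <= 2 * e1.
      rewrite (le_trans (ler_distD (a x * derive1 A x) _ _)) //.
      by rewrite [`|k u - _|]distrC mulr2n mulrDl !mul1r lerD.
    have : `|(k u - k v) * slope y (AA v)| <= 2 * e1 * (L + 1).
      by rewrite normrM ler_pM // (le_trans sv) // lerDl.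
    move/le_trans; apply; rewrite /e1 le_eqVlt; apply/orP; left; apply/eqP.
    by field; lra.
  have B3 : `|r u - r v| <= e / 2.
    rewrite (le_trans (ler_distD (derive1 a x * y (A x) + derive1 b x) _ _)) //.
    rewrite [`|r u - _|]distrC; lra.
  have E1 : e / (1 - rho) = e + rho * (e / (1 - rho)) by field; lra.
  rewrite (le_trans (ler_normD _ _)) // [in leRHS]E1 exprS.
  have := ler_normD ((k u - k v) * slope y (AA v)) (r u - r v).
  have -> : 2 * L * (rho * rho ^+ n) = rho * (2 * L * rho ^+ n) by ring.
  lra.
have slope_cvg x : `|x - p| < d -> cvg (slope y @ offdiag x).
  move=> xd; apply/cauchy_cvgP/cauchy_exP => e e0.
  have e'0 : 0 < e / 4 * (1 - rho) by rewrite mulr_gt0 //; lra.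
  have e40 : 0 < e / 4 by lra.
  have [n nP] := @geometric_small R (2 * L) rho (e / 4) ltac:(by rewrite r0) e40.
  have [E FE HE] := osc _ e'0 n x xd.
  have [u Eu] := filter_ex FE.
  exists (slope y u); apply: filterS FE => v Ev; rewrite /ball /=.
  rewrite (le_lt_trans (HE _ _ Eu Ev)) //.
  have -> : e / 4 * (1 - rho) / (1 - rho) = e / 4 by field; lra.
  lra.
have dy x : `|x - p| < d -> is_derive x 1 y (lim (slope y @ offdiag x)).
  by move=> xd; apply: is_derive_slope; exact: slope_cvg.
move=> x xd; split; first by case: (dy x xd).
apply/continuous_distP => e e0; have e2 : 0 < e / 2 by lra.
have /cvgrPdist_le /(_ _ e2)/offdiagP[c c0 cP] := slope_cvg x xd.
exists (Num.min c (d - `|x - p|)); first by rewrite lt_min c0 subr_gt0.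
move=> z; rewrite lt_min => /andP[zc zx].
have zd : `|z - p| < d by rewrite (le_lt_trans (ler_distD x _ _)) // -ltrBrDr.
rewrite (is_derive1_val (dy x xd)) (is_derive1_val (dy z zd)).
set lx := lim _ in cP *.
suff : `|lx - lim (slope y @ offdiag z)| <= e / 2 by rewrite distrC; lra.
(* Pairs near [(z, z)] are also pairs near [(x, x)], so the bound on slopes around [x] passes to the
   limit at [z]. *)
have cz : (fun u => `|lx - slope y u|) @ offdiag z --> `|lx - lim (slope y @ offdiag z)|.
  by apply: cvg_norm; apply: cvgB; [exact: cvg_cst | exact: slope_cvg].
apply: (closed_cvg (fun v => v <= e / 2) (@closed_le _ _) _ _ cz).
apply/offdiagP; exists (Num.min (c - `|z - x|) 1).
  by rewrite lt_min ltr01 subr_gt0 zc.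
move=> s t; rewrite !lt_min => /andP[sc _] /andP[tc _] st; apply: cP => //.
  by rewrite (le_lt_trans (ler_distD z _ _)) // -ltrBrDr.
by rewrite (le_lt_trans (ler_distD z _ _)) // -ltrBrDr.
Qed.

End contraction.

Section cohomological_equation.
Variables (R : realType) (al : R).
Hypothesis al01 : 0 <= al <= 1.
Implicit Types (A y a b f : R -> R) (p d rho x : R).

Lemma lipschitz_at_derive1_le f x c d : 0 < d -> derivable f x 1 ->
  (forall s, `|s - x| < d -> `|f s - f x| <= c * `|s - x|) -> `|derive1 f x| <= c.
Proof.
move=> d0 /derivable_is_derive1/is_derive_distP H lip.
apply/ler_addgt0Pr => e e0; have [d' d'0 dP] := H e e0.
pose h := Num.min d d' / 2.
have m0 : 0 < Num.min d d' by rewrite lt_min d0.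
have h0 : 0 < h by rewrite divr_gt0.
have hd : h < Num.min d d' by rewrite /h; lra.
move: hd; rewrite lt_min => /andP[hd hd'].
have := dP (x + h); have := lip (x + h).
rewrite addrAC subrr add0r gtr0_norm // => /(_ hd) h1 /(_ hd') h2.
have : `|derive1 f x| * h <= (c + e) * h.
  rewrite -{1}(gtr0_norm h0) -normrM mulrDl.
  rewrite -[X in `|X|](subrK (f (x + h) - f x)) (le_trans (ler_normD _ _)) //.
  by rewrite addrC lerD // distrC.
by rewrite ler_pM2r.
Qed.

(** The variable coefficient [a] is there for the induction: differentiating [y = a (y o A) + b]
    gives an equation of the same kind for [y'], with coefficient [a A'], still at most 1 in
    absolute value because [A] contracts, and right-hand side [a' (y o A) + b']. *)
Lemma Cr_at_cohomology n A y a b p d rho : 0 < d -> 0 <= rho < 1 -> A p = p ->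
  (forall s t, `|s - p| < d -> `|t - p| < d -> `|A s - A t| <= rho * `|s - t|) ->
  (forall s t, `|s - p| < d -> `|t - p| < d -> A s = A t -> s = t) ->
  (forall s, `|s - p| < d -> `|a s| <= 1) ->
  (forall s, `|s - p| < d -> {for s, continuous y}) ->
  (forall s, `|s - p| < d -> y s = a s * y (A s) + b s) ->
  Cr_at al n A p -> Cr_at al n a p -> Cr_at al n b p -> Cr_at al n y p.
Proof.
move=> d0 r01 Ap; have /andP[r0 r1] := r01.
have /andP[al0 al1] := al01.
elim: n a b y d d0 => [|n IH] a b y d d0 ctr inj a1 cy eqy hA ha hb.
  split; first by apply/near_distP; exists d.
  have pd : `|p - p| < d by rewrite subrr normr0.
  have [c c0 cP] := (continuous_distP _ _).1 (cy _ pd) _ ltr01.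
  (* For [al = 0] the power is constantly 1, even at distance 0, and only boundedness near [p] is at
     stake. *)
  have := al0; rewrite le_eqVlt => /predU1P[alE|alp].
    exists 2, c; split => // s t sc tc; rewrite -alE powRr0 mulr1.
    rewrite (le_trans (ler_distD (y p) _ _)) // [`|y p - _|]distrC.
    by have := cP _ sc; have := cP _ tc; lra.
  have [_ [Ca [da [Ca0 da0 Ha]]]] := ha; have [_ [Cb [db [Cb0 db0 Hb]]]] := hb.
  set M := 1 + `|y p|.
  have M0 : 0 <= M by rewrite addr_ge0.
  have yM s : `|s - p| < c -> `|y s| <= M.
    move=> /cP ys; rewrite -[y s](subrK (y p)) (le_trans (ler_normD _ _)) //.
    by rewrite lerD2r ltW.
  pose d' := Num.min (Num.min d c) (Num.min da db).
  have d'0 : 0 < d' by rewrite !lt_min d0 c0 da0.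
  have dd s : `|s - p| < d' -> [/\ `|s - p| < d, `|s - p| < c, `|s - p| < da & `|s - p| < db].
    by rewrite !lt_min => /andP[/andP[? ?] /andP[? ?]].
  have C0 : 0 <= Ca * M + Cb by rewrite addr_ge0 // mulr_ge0.
  exists ((Ca * M + Cb) / (1 - rho `^ al)), d'; split => //.
    rewrite divr_ge0 // subr_ge0.
    have : rho `^ al <= 1 `^ al by apply: ge0_ler_powR; rewrite ?nnegrE // ltW.
    by rewrite powR1.
  apply: (@contraction_holder R A) => //.
  - by move=> s t /dd[? _ _ _] /dd[? _ _ _]; exact: ctr.
  - exact: cy.
  move=> s t /dd[s1 s2 s3 s4] /dd[t1 t2 t3 t4].
  rewrite (eqy _ s1) (eqy _ t1).
  have -> : a s * y (A s) + b s - (a t * y (A t) + b t) =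
    a s * (y (A s) - y (A t)) + ((a s - a t) * y (A t) + (b s - b t)) by ring.
  rewrite (le_trans (ler_normD _ _)) // lerD //.
    by rewrite normrM ler_piMl // a1.
  rewrite (le_trans (ler_normD _ _)) // [in leRHS]mulrDl lerD ?Hb //.
  rewrite normrM mulrAC ler_pM ?Ha // yM //.
  rewrite -[X in _ - X]Ap (le_lt_trans (ctr _ _ t1 pd)) //.
  by rewrite (le_lt_trans _ t2) // ler_piMl // ltW.
have yn : Cr_at al n y p.
  by apply: (IH a b y d) => //; exact: Cr_at_pred.
have [/near_distP[dA dA0 HA] hA'] := hA; have [/near_distP[da da0 Ha] ha'] := ha.
have [/near_distP[db db0 Hb] hb'] := hb.
have [/near_distP[eA eA0 KA] [/near_distP[ea ea0 Ka] /near_distP[eb eb0 Kb]]] :=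
  (Cr_at_near_continuous hA', (Cr_at_near_continuous ha', Cr_at_near_continuous hb')).
have pd : `|p - p| < d by rewrite subrr normr0.
have [c c0 cP] := (continuous_distP _ _).1 (cy _ pd) _ ltr01.
have [La [la [La0 la0 Hla]]] := Cr_at_lipschitz ha.
have [Lb [lb [Lb0 lb0 Hlb]]] := Cr_at_lipschitz hb.
set M := 1 + `|y p|.
have M0 : 0 <= M by rewrite addr_ge0.
have yM s : `|s - p| < c -> `|y s| <= M.
  move=> /cP ys; rewrite -[y s](subrK (y p)) (le_trans (ler_normD _ _)) //.
  by rewrite lerD2r ltW.
pose d' := \big[Num.min/d]_(x <- [:: c; la; lb; dA; da; db; eA; ea; eb]) x.
have d'0 : 0 < d' by rewrite /d' !big_cons big_nil !lt_min c0 la0 lb0 dA0 da0 db0 eA0 ea0 eb0.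
have lt_d' s : `|s - p| < d' -> [&& `|s - p| < c, `|s - p| < la, `|s - p| < lb,
   `|s - p| < dA, `|s - p| < da, `|s - p| < db, `|s - p| < eA, `|s - p| < ea,
   `|s - p| < eb & `|s - p| < d].
  by rewrite /d' !big_cons big_nil !lt_min.
have ltd s : `|s - p| < d' -> `|s - p| < d by move=> /lt_d'; do !case/andP=> _.
have ltc s : `|s - p| < d' -> `|s - p| < c by move=> /lt_d'/andP[].
have ball_A e s : `|s - p| < d -> `|s - p| < e -> `|A s - p| < e.
  move=> sd se; rewrite -[X in _ - X]Ap (le_lt_trans (ctr _ _ sd pd)) //.
  by rewrite (le_lt_trans _ se) // ler_piMl // ltW.
have C0 : 0 <= La * M + Lb by rewrite addr_ge0 // mulr_ge0.
have ctr' s t : `|s - p| < d' -> `|t - p| < d' -> `|A s - A t| <= rho * `|s - t|.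
  by move=> /ltd ? /ltd ?; exact: ctr.
pose L := (La * M + Lb) / (1 - rho).
have L0 : 0 <= L by rewrite divr_ge0 //; lra.
(* Now that [a] and [b] are Lipschitz, [contraction_holder] applies with exponent 1 and supplies the
   bound on slopes that [derive_cohomology] starts from. *)
have lipy s t : `|s - p| < d' -> `|t - p| < d' -> `|y s - y t| <= L * `|s - t|.
  move=> sd td.
  have := @contraction_holder R A y p d' rho 1 (La * M + Lb) d'0 r01 Ap ltr01 C0 ctr'
    (cy _ pd) _ s t sd td.
  rewrite !powRr1 //; apply; move=> {sd td} {}s {}t sd td; rewrite powRr1 //.
  have := lt_d' _ td; have := lt_d' _ sd.
  move=> /and5P[s1 s2 s3 _ _] /and5P[t1 t2 t3 _ _].
  rewrite (eqy _ (ltd _ sd)) (eqy _ (ltd _ td)).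
  have -> : a s * y (A s) + b s - (a t * y (A t) + b t) =
    a s * (y (A s) - y (A t)) + ((a s - a t) * y (A t) + (b s - b t)) by ring.
  rewrite (le_trans (ler_normD _ _)) // lerD //.
    by rewrite normrM ler_piMl // a1 // ltd.
  rewrite (le_trans (ler_normD _ _)) // [in leRHS]mulrDl lerD ?Hlb //.
  by rewrite normrM mulrAC ler_pM ?Hla // yM // ball_A // ltd.
have near_in x f e : `|x - p| < e -> (forall z, `|z - p| < e -> derivable f z 1) ->
    \forall z \near x, derivable f z 1.
  move=> xe H; apply/near_distP; exists (e - `|x - p|); first by rewrite subr_gt0.
  by move=> z zx; apply: H; rewrite (le_lt_trans (ler_distD x _ _)) // -ltrBrDr.
have C1 f : [\/ f = A, f = a | f = b] -> forall x, `|x - p| < d' ->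
     (\forall z \near x, derivable f z 1) /\ {for x, continuous (derive1 f)}.
  move=> hf x /lt_d'/and5P[_ _ _ x1 /and5P[x2 x3 x4 x5 /andP[x6 _]]].
  case: hf => ->; split.
  - exact: near_in x1 HA.
  - exact: KA.
  - exact: near_in x2 Ha.
  - exact: Ka.
  - exact: near_in x3 Hb.
  - exact: Kb.
have C1y : forall x, `|x - p| < d' -> derivable y x 1 /\ {for x, continuous (derive1 y)}.
  apply: (@derive_cohomology R A y a b p d' rho L) => //.
  - by move=> s t /ltd ? /ltd ?; exact: inj.
  - by move=> s /ltd; exact: a1.
  - by move=> s /ltd; exact: eqy.
split; first by apply/near_distP; exists d' => // x /C1y[].
have dA1 s : `|s - p| < d' -> `|derive1 A s| <= rho.
  move=> sd'; apply: (@lipschitz_at_derive1_le _ _ _ (d' - `|s - p|)).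
  - by rewrite subr_gt0.
  - by apply: HA; have /and5P[_ _ _ ? _] := lt_d' _ sd'.
  - move=> t td; rewrite ctr' //.
    by rewrite (le_lt_trans (ler_distD s _ _)) // -ltrBrDr.
apply: (IH (fun s => a s * derive1 A s)
           (fun s => derive1 a s * y (A s) + derive1 b s) _ d' d'0) => //.
- by move=> s t /ltd ? /ltd ?; exact: inj.
- move=> s sd'; rewrite normrM -[1]mul1r ler_pM ?a1 ?ltd //.
  by rewrite (le_trans (dA1 _ sd')) // ltW.
- by move=> s /C1y[].
- move=> s sd'; apply: is_derive1_val.
  have sA : `|A s - p| < d' by rewrite ball_A // ltd.
  have dy := derivable_is_derive1 (C1y _ sA).1.
  have d1 f (hf : [\/ f = A, f = a | f = b]) :=
    derivable_is_derive1 (nbhs_singleton (C1 f hf s sd').1).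
  have da1 := d1 a ltac:(exact: Or32); have db1 := d1 b ltac:(exact: Or33).
  have dAs := d1 A ltac:(exact: Or31).
  have H := is_deriveD (is_deriveM da1 (is_derive1_comp dy dAs)) db1.
  apply: (@near_eq_is_derive _ _ _ (fun t => a t * y (A t) + b t)).
    apply/near_distP; exists (d' - `|s - p|); first by rewrite subr_gt0.
    move=> t td; rewrite -eqy //.
    by apply: ltd; rewrite (le_lt_trans (ler_distD s _ _)) // -ltrBrDr.
  apply: is_derive_eq H _; rewrite /GRing.scale /=; ring.
- exact: Cr_at_pred.
- by apply: Cr_atM => //; exact: Cr_at_pred.
- apply: Cr_atD => //; apply: Cr_atM => //; apply: Cr_at_comp => //.
  + by rewrite Ap.
  + exact: Cr_at_pred.
  + exact: Cr_at_lipschitz hA.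
Qed.

End cohomological_equation.

(** * Ping-pong and hyperbolic fixed points *)

Section intervals.
Variable R : realType.
Implicit Types (h : R -> R) (a b : R).

(** Compactness of [[a, b]] as induction: the supremum of the [t] with [P a t] is attained and
    cannot lie before [b]. Glueing is only asked of intervals that overlap, which leaves room for
    properties involving a uniform scale. *)
Lemma interval_induction (P : R -> R -> Prop) :
  (forall x, exists2 d, 0 < d & forall u v, x - d < u -> u <= v -> v < x + d -> P u v) ->
  (forall a u v w, a <= u -> u < v -> v <= w -> P a v -> P u w -> P a w) ->
  forall a b, a <= b -> P a b.
Proof.
move=> loc glue a b ab; pose S := [set t | a <= t <= b /\ P a t].
have Sa : S a.
  have [d d0 dP] := loc a; split; first by rewrite lexx.
  by apply: dP => //; lra.
have supS : has_sup S by split; [exists a | exists b => t [/andP[]]].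
set s := sup S.
have as_ : a <= s by apply: (ub_le_sup supS.2).
have sb : s <= b by apply: (ge_sup supS.1) => t [/andP[]].
have [d d0 dP] := loc s.
have [t [/andP[at_ tb] Pt] st] := sup_adherent d0 supS.
have ts : t <= s by apply: (ub_le_sup supS.2); split => //; rewrite at_.
pose w := Num.min b (s + d / 2).
have tw : t <= w by rewrite le_min tb; lra.
have ws : w < s + d by rewrite gt_min; apply/orP; right; lra.
have Pw : P a w.
  have := at_; rewrite le_eqVlt => /predU1P[ta|ta].
    by apply: dP => //; [rewrite ta | rewrite ta].
  pose u := Num.max a ((s - d + t) / 2).
  have ut : u < t by rewrite gt_max ta; rewrite -/s in st; lra.
  apply: (glue a u t w) => //; first by rewrite le_max lexx.
  apply: dP => //; last by rewrite (le_trans (ltW ut)).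
  by rewrite lt_max; apply/orP; right; rewrite -/s in st; lra.
have : S w by split => //; rewrite (le_trans at_ tw) ge_min lexx.
move=> /(ub_le_sup supS.2); rewrite -/s ge_min => /orP[bs|]; last lra.
by have -> : b = w; first by rewrite /w; case: leP => //; lra.
Qed.

Lemma uniform_continuity h a b e : continuous h -> a <= b -> 0 < e ->
  exists2 d, 0 < d & forall s t, a <= s <= b -> a <= t <= b -> `|s - t| < d ->
    `|h s - h t| < e.
Proof.
move=> ch ab e0.
pose P u v := exists2 d, 0 < d & forall s t, u <= s <= v -> u <= t <= v ->
  `|s - t| < d -> `|h s - h t| < e.
apply: (@interval_induction P) => // [x|{ab}{}a u v w au uv vw].
  have e2 : 0 < e / 2 by lra.
  have [d d0 dP] := (continuous_distP _ _).1 (ch x) _ e2.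
  exists d => // u v xu uv vx; exists 1 => // s t /andP[us sv] /andP[ut tv] _.
  rewrite (le_lt_trans (ler_distD (h x) _ _)) // [`|h x - _|]distrC (splitr e).
  by apply: ltrD; apply: dP; rewrite ltr_distl; apply/andP; split; lra.
(* Two points closer than the overlap [v - u] lie together in one of the two intervals. *)
move=> [d1 d10 H1] [d2 d20 H2]; exists (Num.min (Num.min d1 d2) (v - u)).
  by rewrite !lt_min d10 d20 subr_gt0.
move=> s t /andP[as_ sw] /andP[at_ tw]; rewrite !lt_min => /andP[/andP[st1 st2] st3].
have [sv|sv] := leP s v; have [tv|tv] := leP t v.
- by apply: H1 => //; apply/andP.
- apply: H2 => //; apply/andP; split => //; last by lra.
  by move: st3; rewrite ltr_distl => /andP[]; lra.
- apply: H2 => //; apply/andP; split => //; first by lra.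
  by move: st3; rewrite ltr_distl => /andP[]; lra.
- by apply: H2 => //; apply/andP; split => //; lra.
Qed.

(** A substitute for a Lipschitz bound on [ln h] when [h] is merely continuous: the error [e]
    absorbs nearby points by uniform continuity, and [C] handles points further apart. *)
Lemma log_oscillation h a b e : a <= b -> continuous h -> (forall x, 0 < h x) ->
  0 < e -> exists2 C, 0 <= C & forall s t, a <= s <= b -> a <= t <= b ->
    h s <= h t * expR (e + C * `|s - t|).
Proof.
move=> ab ch h0 e0.
have cw : {within `[a, b], continuous h} by apply: continuous_subspaceT.
have [u uab umin] := EVT_min ab cw; have [v vab vmax] := EVT_max ab cw.
have em0 : 0 < e * h u by rewrite mulr_gt0.
have [d d0 dP] := uniform_continuity ch ab em0.
(* The ratio of maximum to minimum over [d]: for [|s - t| >= d] the factor [1 + C * |s - t|] already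
   exceeds that ratio. *)
exists (h v / (h u * d)) => [|s t sab tab].
  by rewrite divr_ge0 ?mulr_ge0 // ltW.
have hut : h u <= h t by apply: umin; rewrite in_itv.
have hsv : h s <= h v by apply: vmax; rewrite in_itv.
have E := expR_ge1Dx (e + h v / (h u * d) * `|s - t|).
apply: le_trans (ler_wpM2l (ltW (h0 t)) E).
have C0 : 0 <= h v / (h u * d) by rewrite divr_ge0 ?mulr_ge0 // ltW.
have [st|st] := ltP `|s - t| d.
  have := dP _ _ sab tab st; rewrite ltr_distl => /andP[_ hst].
  have : 0 <= h v / (h u * d) * `|s - t| by rewrite mulr_ge0.
  set z := _ / _ * _ => z0.
  have : h t * 1 + e * h u <= h t * (1 + (e + z)).
    have ez : e <= e + z by lra.
    by rewrite mulrDr lerD2l mulrC; apply: ler_pM => //; exact: ltW.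
  lra.
have K : h v <= h u * (h v / (h u * d) * `|s - t|).
  have -> : h u * (h v / (h u * d) * `|s - t|) = h v * (`|s - t| / d).
    by field; rewrite !gt_eqF.
  by rewrite ler_pMr // ler_pdivlMr // mul1r.
rewrite (le_trans hsv) // (le_trans K) // ler_pM //; first exact: ltW.
  by rewrite mulr_ge0.
lra.
Qed.

End intervals.

(** * A contracting word in a ping-pong pair of C^1 maps *)

Section ping_pong.
Variables (R : realType) (a b : R) (phi : bool -> R -> R).
Hypotheses (ab : a < b) (phi_incr : forall i, {homo phi i : x y / x < y}).
Hypothesis phi_itv : forall i x, a <= x <= b -> a <= phi i x <= b.
Hypothesis phi_disj : phi true b < phi false a.
Hypothesis phi_derivable : forall i (x : R), derivable (phi i) x 1.
Hypothesis phi_derive_cont : forall i, continuous (derive1 (phi i)).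
Hypothesis phi_derive_gt0 : forall i x, 0 < derive1 (phi i) x.
Implicit Types (w : seq bool) (X Y : seq bool -> R).

Definition word w : R -> R := foldr (fun i g => phi i \o g) id w.

Fixpoint word_avg n X : R :=
  if n is m.+1 then
    (word_avg m (fun w => X (true :: w)) + word_avg m (fun w => X (false :: w))) / 2
  else X [::].

(** The recursion splits off the first letter, applied last; images of [[a, b]] are nested when the
    last letter, applied first, varies, so the length estimate needs this other splitting. *)
Lemma word_avg_rcons n X : word_avg n.+1 X =
  word_avg n (fun w => (X (rcons w true) + X (rcons w false)) / 2).
Proof.
elim: n X => [//|n IH] X.
have S m Y : word_avg m.+1 Y = (word_avg m (fun w => Y (true :: w)) +
  word_avg m (fun w => Y (false :: w))) / 2 by [].
by rewrite [LHS]S [RHS]S !IH.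
Qed.

Lemma word_avg_le n X Y : (forall w, X w <= Y w) -> word_avg n X <= word_avg n Y.
Proof.
elim: n X Y => [|n IH] X Y XY /=; first exact: XY.
by rewrite ler_pM2r ?invr_gt0 // lerD // IH.
Qed.

Lemma word_avg_lin n (c e : R) X Y :
  word_avg n (fun w => c * X w + e * Y w) = c * word_avg n X + e * word_avg n Y.
Proof. by elim: n X Y => [//|n IH] X Y /=; rewrite !IH; field. Qed.

Lemma word_avg_exists n X : exists2 w, size w = n & X w <= word_avg n X.
Proof.
elim: n X => [|n IH] X /=; first by exists [::].
have [u un hu] := IH (fun w => X (true :: w)).
have [v vn hv] := IH (fun w => X (false :: w)).
have [h|h] := leP (word_avg n (fun w => X (true :: w)))
                  (word_avg n (fun w => X (false :: w))).
- by exists (true :: u); [rewrite /= un | rewrite (le_trans hu) //; lra].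
- by exists (false :: v); [rewrite /= vn | rewrite (le_trans hv) //; lra].
Qed.

Definition word_len w := word w b - word w a.

(** Only proper suffixes count: these are the intervals to which the successive letters are applied,
    hence those on which the derivatives of the letters are evaluated. *)
Fixpoint word_total w : R := if w is _ :: v then word_len v + word_total v else 0.

Lemma word_incr w : {homo word w : x y / x < y}.
Proof. by elim: w => [//|i w IH] x y xy /=; apply: phi_incr; exact: IH. Qed.

Lemma word_homo w : {homo word w : x y / x <= y}.
Proof. by move=> x y; rewrite le_eqVlt => /predU1P[->//|/(word_incr w)/ltW]. Qed.

Lemma word_itv w x : a <= x <= b -> a <= word w x <= b.
Proof. by elim: w => [//|i w IH] /IH; exact: phi_itv. Qed.

Lemma word_rcons w i : word (rcons w i) = word w \o phi i.
Proof. by elim: w => [//|j w IH]; rewrite rcons_cons [LHS]/= IH. Qed.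

Lemma word_len_ge0 w : 0 <= word_len w.
Proof. by rewrite subr_ge0 ltW // word_incr. Qed.

Lemma word_total_ge0 w : 0 <= word_total w.
Proof. by elim: w => [//|i w IH] /=; rewrite addr_ge0 // word_len_ge0. Qed.

Lemma word_len_split w : word_len (rcons w true) + word_len (rcons w false) <= word_len w.
Proof.
rewrite /word_len !word_rcons /=.
have h : a <= a <= b by rewrite lexx ltW.
have h' : a <= b <= b by rewrite lexx ltW.
have /andP[h1 _] := phi_itv true h; have /andP[_ h2] := phi_itv false h'.
have := word_homo w h1; have := word_homo w h2.
have := word_incr w phi_disj; lra.
Qed.

Lemma word_avg_len n : word_avg n word_len <= (b - a) * 2^-1 ^+ n.
Proof.
elim: n => [|n IH]; first by rewrite expr0 mulr1.
rewrite word_avg_rcons.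
have /le_trans -> // : word_avg n (fun w =>
    (word_len (rcons w true) + word_len (rcons w false)) / 2) <=
  word_avg n (fun w => 2^-1 * word_len w + 0 * word_len w).
  apply: word_avg_le => w; have := word_len_split w; lra.
rewrite word_avg_lin mul0r addr0 exprS mulrCA; lra.
Qed.

Lemma word_avg_total n : word_avg n word_total <= 2 * (b - a) * (1 - 2^-1 ^+ n).
Proof.
elim: n => [|n IH] /=; first by rewrite expr0 subrr mulr0.
have E : word_avg n (fun w => word_len w + word_total w) =
    word_avg n word_len + word_avg n word_total.
  rewrite -[in RHS](mul1r (word_avg n word_len)).
  rewrite -[in RHS](mul1r (word_avg n word_total)) -word_avg_lin.
  by congr word_avg; apply/funext => w; rewrite !mul1r.
have := word_avg_len n; rewrite E exprS; lra.
Qed.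

Lemma word_derive w x : derivable (word w) x 1 /\ 0 < derive1 (word w) x.
Proof.
elim: w => [|i w [IH IH0]] /=; first by rewrite derive1_id.
have H := is_derive1_comp (derivable_is_derive1 (@phi_derivable i (word w x)))
  (derivable_is_derive1 IH).
by split; [case: H | rewrite (is_derive1_val H) mulr_gt0].
Qed.

Lemma word_derive_cons i w x : derive1 (word (i :: w)) x =
  derive1 (phi i) (word w x) * derive1 (word w) x.
Proof.
have [h _] := word_derive w x.
exact: is_derive1_val (is_derive1_comp
  (derivable_is_derive1 (@phi_derivable i (word w x))) (derivable_is_derive1 h)).
Qed.

Lemma word_continuous w : continuous (word w).
Proof.
by move=> x; have [h _] := word_derive w x;
  exact: is_derive1_continuous (derivable_is_derive1 h).
Qed.

Lemma word_distortion e : 0 < e -> exists2 C, 0 <= C & forall w x y,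
  a <= x <= b -> a <= y <= b ->
  derive1 (word w) x <= derive1 (word w) y * expR ((size w)%:R * e + C * word_total w).
Proof.
move=> e0.
have H i := log_oscillation (ltW ab) (@phi_derive_cont i) (@phi_derive_gt0 i) e0.
have [C1 C10 H1] := H true; have [C2 C20 H2] := H false.
have {H1 H2 H} H i s t : a <= s <= b -> a <= t <= b ->
    derive1 (phi i) s <= derive1 (phi i) t * expR (e + (C1 + C2) * `|s - t|).
  move=> sab tab; have n0 := normr_ge0 (s - t).
  have := mulr_ge0 C10 n0; have := mulr_ge0 C20 n0 => ? ?.
  by case: i; [apply: le_trans (H1 _ _ sab tab) _ | apply: le_trans (H2 _ _ sab tab) _];
    rewrite ler_wpM2l ?(ltW (phi_derive_gt0 _ _)) // ler_expR mulrDl; lra.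
exists (C1 + C2) => [|w x y xab yab]; first lra.
elim: w => [|i w IH]; first by rewrite /= !derive1_id mul0r mulr0 addr0 expR0 mulr1.
rewrite !word_derive_cons.
have dl : `|word w x - word w y| <= word_len w.
  move: xab yab => /andP[ax xb] /andP[ay yb].
  have := word_homo w ax; have := word_homo w ay.
  have := word_homo w xb; have := word_homo w yb.
  by rewrite ler_distl /word_len => *; apply/andP; split; lra.
have K : expR (e + (C1 + C2) * `|word w x - word w y|) <=
    expR (e + (C1 + C2) * word_len w).
  by rewrite ler_expR lerD2l ler_wpM2l //; lra.
have := H i _ _ (word_itv w xab) (word_itv w yab).
move=> /le_trans /(_ (ler_wpM2l (ltW (phi_derive_gt0 i _)) K)) H1.
have -> : (size (i :: w))%:R * e + (C1 + C2) * word_total (i :: w) =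
   (e + (C1 + C2) * word_len w) + ((size w)%:R * e + (C1 + C2) * word_total w).
  rewrite /= -[(size w).+1]add1n natrD; ring.
rewrite expRD mulrACA; apply: ler_pM => //; first exact: ltW.
by apply: ltW; have [] := word_derive w x.
Qed.

(* Averaging over the words of length n: the images of [a, b] under the 2^n words
   are disjoint, and the images under proper suffixes have bounded total length. *)
Lemma ping_pong_hyperbolic : exists w p, [/\ a <= p <= b, word w p = p
  & derive1 (word w) p < 1].
Proof.
(* The distortion of a word of length n then costs [(3/2)^n] up to a constant, against a mean
   contraction of order [2^-n]; the product [(3/4)^n] tends to 0. *)
pose e : R := ln (3 / 2).
have e0 : 0 < e by rewrite ln_gt0 //; lra.
have [C C0 HC] := word_distortion e0.
pose K := 2 * expR (C * (4 * (b - a))).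
have [n nP] := @geometric_small R K (3 / 4) 1 ltac:(lra) ltr01.
(* With these weights both averages are at most 1, so one word keeps the weighted sum at most 2 and
   thus controls its length and its distortion simultaneously. *)
pose c1 : R := 2 ^+ n / (b - a); pose c2 : R := (2 * (b - a))^-1.
have p2 : 0 < 2 ^+ n :> R by rewrite exprn_gt0.
have ba : 0 < b - a by rewrite subr_gt0.
have c10 : 0 < c1 by rewrite divr_gt0.
have c20 : 0 < c2 by rewrite invr_gt0; lra.
have [w wn] := word_avg_exists n (fun w => c1 * word_len w + c2 * word_total w).
rewrite word_avg_lin => Z.
have Z2 : c1 * word_len w + c2 * word_total w <= 2.
  apply: le_trans Z _.
  have A1 : c1 * word_avg n word_len <= 1.
    rewrite -[leRHS](_ : c1 * ((b - a) * 2^-1 ^+ n) = 1).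
      by rewrite ler_pM2l // word_avg_len.
    by rewrite /c1 exprVn; field; rewrite !gt_eqF.
  have A2 : c2 * word_avg n word_total <= 1.
    have := word_avg_total n.
    have : 2 * (b - a) * (1 - 2^-1 ^+ n) <= 2 * (b - a).
      by rewrite ler_piMr ?lerBlDr ?lerDl ?exprn_ge0 //; lra.
    move=> h /le_trans /(_ h) h'; rewrite /c2 mulrC ler_pdivrMr ?mul1r //; lra.
  lra.
have l0 := mulr_ge0 (ltW c10) (word_len_ge0 w).
have t0 := mulr_ge0 (ltW c20) (word_total_ge0 w).
have L : word_len w <= 2 * (b - a) * 2^-1 ^+ n.
  have -> : word_len w = c1 * word_len w * ((b - a) * 2^-1 ^+ n).
    by rewrite /c1 exprVn; field; rewrite !gt_eqF.
  rewrite -[leRHS]mulrA; apply: ler_wpM2r; last lra.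
  by rewrite mulr_ge0 ?exprn_ge0 ?invr_ge0 // ltW.
have T : word_total w <= 4 * (b - a).
  have h : c2 * word_total w <= 2 by lra.
  by move: h; rewrite /c2 mulrC ler_pdivrMr; lra.
have hyp x : a <= x <= b -> derive1 (word w) x < 1.
  move=> xab.
  have [||y yab E] := @MVT R (word w) (derive1 (word w)) a b ab.
  - by move=> z _; have [h _] := word_derive w z; exact: derivable_is_derive1.
  - by apply: continuous_subspaceT; exact: word_continuous.
  have yab' : a <= y <= b by move: yab; rewrite in_itv /= => /andP[/ltW -> /ltW ->].
  have Dy : derive1 (word w) y <= 2 * 2^-1 ^+ n.
    by rewrite -(ler_pM2r ba) -E mulrAC.
  apply: le_lt_trans (HC w x y xab yab') _.
  apply: le_lt_trans nP.
  have -> : K * (3 / 4) ^+ n = (2 * 2^-1 ^+ n) * (expR (C * (4 * (b - a))) * (3/2) ^+ n).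
    by rewrite -[3/4](_ : (3/2) * 2^-1 = _) ?exprMn /K; [ring | field].
  have [_ d0] := word_derive w y.
  apply: ler_pM; rewrite ?expR_ge0 ?(ltW d0) //.
  rewrite wn expRD mulrC ler_pM // ?expR_ge0 //.
    by rewrite ler_expR ler_wpM2l.
  by rewrite expRM_natl /e lnK // posrE; lra.
have [||p pab] := @IVT R (fun x => word w x - x) a b 0 (ltW ab).
- apply: continuous_subspaceT => x; apply: cvgB; [exact: word_continuous | exact: cvg_id].
- have ha : a <= a <= b by rewrite lexx ltW.
  have hb : a <= b <= b by rewrite lexx ltW.
  have /andP[h1 _] := word_itv w ha; have /andP[_ h2] := word_itv w hb.
  by rewrite ge_min le_max !subr_le0 subr_ge0 h1 h2 !orbT.
move=> /eqP; rewrite subr_eq0 => /eqP wp.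
by exists w, p; split => //; apply: hyp; move: pab; rewrite in_itv.
Qed.

End ping_pong.

(** * Monotonicity from almost everywhere information *)

Section monotone_from_ae.
Variable R : realType.
Implicit Types (P : R -> R) (a b : R).
Notation mu := (@lebesgue_measure R).

Definition mass_below (W : set R) a t : R := fine (mu (W `&` `]a, t])).

Lemma mass_fin (W : set R) s t : open W -> s <= t ->
  [/\ measurable (W `&` `]s, t]), 0 <= fine (mu (W `&` `]s, t])),
   fine (mu (W `&` `]s, t])) <= t - s &
   (fine (mu (W `&` `]s, t])))%:E = mu (W `&` `]s, t])].
Proof.
move=> oW st.
have mW : measurable (W `&` `]s, t]).
  by apply: measurableI => //; exact: open_measurable.
have le : (mu (W `&` `]s, t]) <= (t - s)%:E)%E.
  apply: (@le_trans _ _ (mu `]s, t])).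
    by apply: le_measure; rewrite ?inE.
  by rewrite lebesgue_measure_itv /= lte_fin; case: ltP => // _; rewrite lee_fin subr_ge0.
have fE : (fine (mu (W `&` `]s, t])))%:E = mu (W `&` `]s, t]).
  by rewrite fineK // ge0_fin_numE // (le_lt_trans le) // ltry.
by split => //; [exact: fine_ge0 | rewrite -lee_fin fE].
Qed.

Lemma mass_belowD (W : set R) a s t : open W -> a <= s -> s <= t ->
  mass_below W a t = mass_below W a s + fine (mu (W `&` `]s, t])).
Proof.
move=> oW as_ st; have [m1 _ _ f1] := mass_fin oW as_.
have [m2 _ _ f2] := mass_fin oW st.
have [m3 _ _ f3] := mass_fin oW (le_trans as_ st).
apply: EFin_inj; rewrite EFinD /mass_below f1 f2 f3 -measureU //.
  rewrite -setIUr; congr (mu (W `&` _)).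
  apply/seteqP; split => x /=; rewrite !in_itv /=.
    by move=> /andP[ax xt]; have [xs|xs] := leP x s; [left; rewrite ax | right; rewrite xt].
  case=> /andP[h1 h2]; apply/andP; split => //.
    exact: le_trans h2 st.
  exact: le_lt_trans h1.
rewrite setIACA setIid; apply/seteqP; split => // x /= [_]; rewrite !in_itv /=.
by move=> [/andP[_ xs] /andP[sx _]]; move: (le_lt_trans xs sx); rewrite ltxx.
Qed.

(* At a maximum of [P + (K + 1) mass_below W] before [b], where the open set [W]
   has small measure and contains [N], the function would still have to increase. *)
Lemma nondecreasing_ae P a b K (N : set R) : a <= b -> 0 <= K ->
  (forall s t, a <= s <= b -> a <= t <= b -> `|P s - P t| <= K * `|s - t|) ->
  measurable N -> mu N = 0%E ->
  (forall x, a <= x -> x < b -> ~ N x -> forall d, 0 < d ->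
     exists y, [/\ x < y, y < x + d & P x < P y]) ->
  P a <= P b.
Proof.
move=> ab K0 lip mN N0 rise; apply/ler_addgt0Pr => e e0.
(* The measure allowed for [W], so that the correction [(K + 1) * psi] stays below [e]. *)
have e'0 : 0 < e / (K + 1) by rewrite divr_gt0 //; lra.
have N1 : (mu N < +oo)%E by rewrite N0 ltry.
have [W [oW NW Wd]] := lebesgue_regularity_outer mN N1 e'0.
have muW : (mu W < (e / (K + 1))%:E)%E.
  have mWN : measurable (W `\` N) by apply: measurableD => //; exact: open_measurable.
  apply: le_lt_trans Wd; rewrite -[in leLHS](setDUK NW).
  have N0' : (mu N <= 0)%E by rewrite N0.
  have := @measureU2 _ _ _ mu _ _ mN mWN.
  by move/le_trans; apply; rewrite -[leRHS]add0e; apply: leeD.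
pose psi := mass_below W a; pose Q t := P t + (K + 1) * psi t.
have psiD s t : a <= s -> s <= t -> 0 <= psi t - psi s <= t - s.
  move=> as_ st; rewrite /psi (mass_belowD oW as_ st) addrAC subrr add0r.
  by have [_ -> ->] := mass_fin oW st.
have psi_lip s t : a <= s <= b -> a <= t <= b -> `|psi s - psi t| <= `|s - t|.
  move=> /andP[as_ sb] /andP[at_ tb]; have [st|/ltW ts] := leP s t.
    have /andP[h1 h2] := psiD _ _ as_ st.
    by rewrite distrC [leRHS]distrC !ger0_norm ?subr_ge0 //; lra.
  have /andP[h1 h2] := psiD _ _ at_ ts.
  by rewrite !ger0_norm ?subr_ge0 //; lra.
have Qc : {within `[a, b], continuous Q}.
  apply/subspace_continuousP => x; rewrite /= in_itv /= => xab.
  apply/cvgrPdist_le => g g0.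
  apply/near_distP; exists (g / (2 * K + 1)); first by rewrite divr_gt0 //; lra.
  move=> y yx; rewrite /= in_itv /= => yab; rewrite distrC /Q.
  have -> : P y + (K + 1) * psi y - (P x + (K + 1) * psi x) =
    (P y - P x) + (K + 1) * (psi y - psi x) by ring.
  rewrite (le_trans (ler_normD _ _)) // normrM (ger0_norm (_ : 0 <= K + 1)); last lra.
  have h1 := lip _ _ yab xab; have h2 := psi_lip _ _ yab xab.
  have h3 : (K + 1) * `|psi y - psi x| <= (K + 1) * `|y - x| by rewrite ler_wpM2l //; lra.
  have h4 : `|y - x| * (2 * K + 1) < g by rewrite -ltr_pdivlMr //; lra.
  lra.
have [c cab cmax] := EVT_max ab Qc.
move: (cab); rewrite in_itv /= => /andP[ac cb].
have cbE : c = b.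
  apply/eqP; rewrite eq_le cb /= leNgt; apply/negP => cb'.
  have [Nc|nNc] := pselect (N c).
    have /near_distP[d d0 dW] : \forall z \near c, W z.
      by apply: open_nbhs_nbhs; split => //; exact: NW.
    pose y := Num.min b (c + d / 2).
    have cy : c < y by rewrite lt_min cb'; lra.
    have yd : y <= c + d / 2 by rewrite ge_min lexx orbT.
    have yb : y <= b by rewrite ge_min lexx.
    (* Inside [W] the mass grows at rate 1, so the gain [K + 1] of the correction outweighs the loss
       of [P], whose rate is at most [K]. *)
    have psiE : psi y = psi c + (y - c).
      rewrite /psi (mass_belowD oW ac (ltW cy)); congr (_ + _).
      rewrite (_ : W `&` _ = `]c, y]%classic); last first.
        apply/seteqP; split => z /=; first by case.
        move=> cz; split => //; apply: dW.
        by move: cz; rewrite in_itv /= => /andP[? ?]; rewrite gtr0_norm ?subr_gt0 //; lra.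
      by rewrite lebesgue_measure_itv /= lte_fin cy.
    have yab : a <= y <= b by rewrite yb (le_trans ac) // ltW.
    have := cmax y; rewrite in_itv /= => /(_ yab).
    have := lip c y; rewrite ac cb yab => /(_ isT isT).
    rewrite [`|c - y|]ler0_norm; last by rewrite subr_le0 ltW.
    rewrite ler_norml => /andP[_ h].
    rewrite leNgt => /negP; apply; rewrite /Q psiE mulrDr addrA.
    have : (K + 1) * (y - c) = K * (y - c) + (y - c) by ring.
    lra.
  have bc : 0 < b - c by rewrite subr_gt0.
  have [y [cy yb Pcy]] := rise c ac cb' nNc _ bc.
  have yb' : y <= b by lra.
  have := cmax y; rewrite in_itv /= yb' (le_trans ac (ltW cy)) => /(_ isT).
  rewrite leNgt => /negP; apply; rewrite /Q ltr_leD // ler_wpM2l //; first lra.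
  by have /andP[] := psiD _ _ ac (ltW cy); rewrite subr_ge0.
have := cmax a; rewrite in_itv /= lexx ab => /(_ isT); rewrite cbE /Q.
have -> : psi a = 0 by rewrite /psi /mass_below set_itvoc0 // setI0 measure0.
rewrite mulr0 addr0 => /le_trans; apply; rewrite lerD2l mulrC -ler_pdivlMr; last lra.
have [mWa _ _ fE] := mass_fin oW ab.
rewrite -lee_fin /psi /mass_below fE ltW // (le_lt_trans _ muW) //.
by apply: le_measure; rewrite ?inE //; exact: open_measurable.
Qed.

End monotone_from_ae.

(** * The transfer function of two conjugated groups *)

Section conjugated_groups.
Variables (R : realType) (al : R) (n : nat).
Implicit Types (A B : R -> R) (x y : R).
Notation mu := (@lebesgue_measure R).

(* [GG A B]: A and B are lifts of theta1(g) and theta2(g) for the same g, matched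
   so that the lift [F] of the conjugacy (with inverse [Fi]) intertwines them. *)
Record conjugated_lifts (F Fi : R -> R) (GG : (R -> R) -> (R -> R) -> Prop) : Prop := {
  lift_homo : {homo F : x y / x < y};
  lift_can : cancel F Fi;
  lift_ican : cancel Fi F;
  lift_lip : exists2 K, 0 < K & forall x y, `|F x - F y| <= K * `|x - y|;
  lift_ilip : exists2 K, 0 < K & forall x y, `|Fi x - Fi y| <= K * `|x - y|;
  lift_deg1 : forall x, F (x + 1) = F x + 1;
  GG_homo : forall A B, GG A B -> {homo A : x y / x < y} /\ {homo B : x y / x < y};
  GG_deg1 : forall A B, GG A B ->
    (forall x, A (x + 1) = A x + 1) /\ (forall x, B (x + 1) = B x + 1);
  GG_shift : GG (fun x => x + 1) (fun x => x + 1);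
  GG_comp : forall A B A' B', GG A B -> GG A' B' -> GG (A \o A') (B \o B');
  GG_inv : forall A B, GG A B -> exists A' B',
    [/\ GG A' B', cancel A A', cancel A' A, cancel B B' & cancel B' B];
  GG_reg : forall A B, GG A B ->
    (forall x, Cr_at al n.+1 A x) /\ (forall x, Cr_at al n.+1 B x);
  GG_conj : forall A B, GG A B -> forall x, F (A x) = B (F x);
  GG_minimal : forall x a b, a < b -> exists A B, GG A B /\ a < A x < b;
  GG_nonfree : exists A B, [/\ GG A B, exists x, A x = x & exists x, A x <> x];
  GG_ergodic : forall O : nat -> nat -> set R, (forall i j, open (O i j)) ->
    (forall i j x, O i j (x + 1) <-> O i j x) ->
    let E := \bigcup_i \bigcap_j O i j in
    (forall A B, GG A B -> forall x, E x -> E (A x)) ->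
    mu (`[0, 1[ `&` E) = 0%E \/ mu (`[0, 1[ `&` E) = 1%E }.

Section transfer_function.
Variables (F Fi : R -> R) (GG : (R -> R) -> (R -> R) -> Prop).
Hypothesis H : conjugated_lifts F Fi GG.

Lemma incr_derive1_ge0R A x : {homo A : x y / x < y} -> derivable A x 1 ->
  0 <= derive1 A x.
Proof.
move=> hA /derivable_is_derive1/is_derive_distP dA; rewrite leNgt; apply/negP => l0.
have l2 : 0 < - derive1 A x / 2 by lra.
have [d d0 dP] := dA _ l2.
have := dP (x + d / 2); rewrite addrAC subrr add0r gtr0_norm; last lra.
have : A x < A (x + d / 2) by apply: hA; lra.
move=> h /(_ ltac:(lra)); rewrite ler_norml => /andP[_].
have : derive1 A x * (d / 2) < 0 by rewrite nmulr_rlt0 //; lra.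
lra.
Qed.

Lemma GG_C1 A B : GG A B ->
  [/\ forall x, derivable A x 1, continuous (derive1 A),
      forall x, derivable B x 1 & continuous (derive1 B)].
Proof.
move=> /(GG_reg H)[hA hB]; split => x.
- by have [/nbhs_singleton] := hA x.
- by have [_ /Cr_at_continuous] := hA x.
- by have [/nbhs_singleton] := hB x.
- by have [_ /Cr_at_continuous] := hB x.
Qed.

Lemma derive1_cancel A A' x : cancel A A' -> derivable A x 1 -> derivable A' (A x) 1 ->
  derive1 A' (A x) * derive1 A x = 1.
Proof.
move=> AK dA dA'.
have := is_derive1_comp (derivable_is_derive1 dA') (derivable_is_derive1 dA).
move/is_derive1_val <-; have -> : A' \o A = id by apply/funext.
exact: derive1_id.
Qed.

(** The inverses are again in the group, hence differentiable, so the chain rule excludes a zero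
    derivative. *)
Lemma GG_derive_gt0 A B : GG A B ->
  (forall x, 0 < derive1 A x) /\ (forall x, 0 < derive1 B x).
Proof.
move=> gAB; have [A' [B' [gAB' AK _ BK _]]] := GG_inv H gAB.
have [dA _ dB _] := GG_C1 gAB; have [dA' _ dB' _] := GG_C1 gAB'.
have [hA hB] := GG_homo H gAB.
split=> x; rewrite lt_neqAle incr_derive1_ge0R // andbT eq_sym.
  have := derive1_cancel AK (dA x) (dA' _).
  by case: eqP => // ->; rewrite mulr0 => /esym/eqP; rewrite oner_eq0.
have := derive1_cancel BK (dB x) (dB' _).
by case: eqP => // ->; rewrite mulr0 => /esym/eqP; rewrite oner_eq0.
Qed.

Lemma GG_id : GG id id.
Proof.
have [A' [B' [gAB' AK _ BK _]]] := GG_inv H (GG_shift H).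
by have := GG_comp H gAB' (GG_shift H);
  congr (GG _ _); apply/funext => x /=; [exact: AK | exact: BK].
Qed.

(** A multiplicative cocycle over the group; it equals [F' x / F' (A x)] wherever [F] has nonzero
    derivatives at [x] and [A x]. *)
Definition derive_ratio A B x := derive1 A x / derive1 B (F x).

Lemma ratio_comp A B A' B' x : GG A B -> GG A' B' ->
  derive_ratio (A \o A') (B \o B') x = derive_ratio A B (A' x) * derive_ratio A' B' x.
Proof.
move=> gAB gAB'; have [dA _ dB _] := GG_C1 gAB; have [dA' _ dB' _] := GG_C1 gAB'.
rewrite /derive_ratio (derive1_comp (dA' x) (dA _)) (derive1_comp (dB' (F x)) (dB _)).
rewrite (GG_conj H gAB').
by have [_ B0] := GG_derive_gt0 gAB; have [_ B0'] := GG_derive_gt0 gAB';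
  field; rewrite !gt_eqF.
Qed.

Lemma ratio_gt0 A B x : GG A B -> 0 < derive_ratio A B x.
Proof. by move=> gAB; have [A0 B0] := GG_derive_gt0 gAB; rewrite divr_gt0. Qed.

Lemma lift_continuous : continuous F.
Proof.
move=> x; have [K K0 HK] := lift_lip H.
by apply: lipschitz_at_continuous; exists K, 1; split => //; exact: ltW.
Qed.

Lemma ratio_continuous A B : GG A B -> continuous (derive_ratio A B).
Proof.
move=> gAB x; have [_ cA _ cB] := GG_C1 gAB; have [_ B0] := GG_derive_gt0 gAB.
apply: cvgM; first exact: cA.
apply: cvgV; first by rewrite gt_eqF.
by apply: continuous_comp; [exact: lift_continuous | exact: cB].
Qed.

(** Since [A = Fi o B o F], the derivative of [A] at [x] is at most that of [B] at [F x] times the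
    two Lipschitz constants, whatever the group element. *)
Lemma ratio_bounded : exists2 K, 0 < K & forall A B x, GG A B -> derive_ratio A B x <= K.
Proof.
have [K1 K10 H1] := lift_lip H; have [K2 K20 H2] := lift_ilip H.
exists (K2 * K1) => [|A B x gAB]; first exact: mulr_gt0.
have [dA _ dB _] := GG_C1 gAB; have [A0 B0] := GG_derive_gt0 gAB.
rewrite /derive_ratio ler_pdivrMr //; apply/ler_addgt0Pr => e e0.
pose g := e / (K2 * K1).
have g0 : 0 < g by rewrite divr_gt0 // mulr_gt0.
have /is_derive_distP /(_ _ g0)[d d0 dP] := derivable_is_derive1 (dB (F x)).
have [d' d'0 d'P] := (continuous_distP _ _).1 (@lift_continuous x) _ d0.
rewrite -[leLHS](gtr0_norm (A0 x)).
apply: (lipschitz_at_derive1_le d'0 (dA x)) => y yx.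
have := dP _ (d'P _ yx); set D := derive1 B (F x) => h.
have D0 : 0 < D by exact: B0.
have h1 : `|B (F y) - B (F x)| <= (D + g) * `|F y - F x|.
  rewrite -[B (F y) - B (F x)](subrK (D * (F y - F x))) (le_trans (ler_normD _ _)) //.
  by rewrite mulrDl addrC lerD // normrM (gtr0_norm D0).
rewrite -{1}(lift_can H (A y)) -{1}(lift_can H (A x)) (le_trans (H2 _ _)) //.
rewrite !(GG_conj H gAB).
have -> : (K2 * K1 * D + e) * `|y - x| = K2 * ((D + g) * (K1 * `|y - x|)).
  by rewrite /g; field; rewrite !gt_eqF.
rewrite ler_wpM2l ?(ltW K20) // (le_trans h1) // ler_wpM2l ?H1 //.
by rewrite addr_ge0 // ltW.
Qed.

Definition ratios x : set R := [set r | exists A B, GG A B /\ r = derive_ratio A B x].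

(** A supremum of continuous functions over the whole group is lower semicontinuous, and it solves
    the cocycle equation exactly because the group is stable under right translation. *)
Definition transfer x := sup (ratios x).

Lemma ratios_has_sup x : has_sup (ratios x).
Proof.
have [K K0 HK] := ratio_bounded; split.
  by exists (derive_ratio id id x), id, id; split => //; exact: GG_id.
by exists K => _ [A [B [gAB ->]]]; exact: HK.
Qed.

Lemma ratio_le_transfer A B x : GG A B -> derive_ratio A B x <= transfer x.
Proof.
by move=> gAB; apply: (ub_le_sup (ratios_has_sup x).2); exists A, B.
Qed.

Lemma transfer_gt0 x : 0 < transfer x.
Proof. exact: lt_le_trans (ratio_gt0 x GG_id) (ratio_le_transfer x GG_id). Qed.

Lemma transfer_bounded : exists2 K, 0 < K & forall x, transfer x <= K.
Proof.
have [K K0 HK] := ratio_bounded; exists K => // x.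
by apply: (ge_sup (ratios_has_sup x).1) => _ [A [B [gAB ->]]]; exact: HK.
Qed.

(** Right translation by [(A, B)] permutes the group, so the ratios at [x] are those at [A x] times
    one positive factor, which comes out of the supremum. *)
Lemma transferE A B x : GG A B -> transfer x = transfer (A x) * derive_ratio A B x.
Proof.
move=> gAB; apply/eqP; rewrite eq_le; apply/andP; split.
  apply: (ge_sup (ratios_has_sup x).1) => _ [A1 [B1 [gAB1 ->]]].
  have [A' [B' [gAB' AK A'K BK B'K]]] := GG_inv H gAB.
  have -> : derive_ratio A1 B1 x = derive_ratio (A1 \o A') (B1 \o B') (A x) * derive_ratio A B x.
    rewrite -ratio_comp //; last exact: GG_comp H _ _ _ _ gAB1 gAB'.
    by congr (derive_ratio _ _ x); apply/funext => z /=; rewrite ?AK ?BK.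
  rewrite ler_wpM2r ?ratio_le_transfer ?ltW ?ratio_gt0 //.
  exact: GG_comp H _ _ _ _ gAB1 gAB'.
rewrite -ler_pdivlMr ?ratio_gt0 //.
apply: (ge_sup (ratios_has_sup (A x)).1) => _ [A1 [B1 [gAB1 ->]]].
rewrite ler_pdivlMr ?ratio_gt0 // -ratio_comp // ratio_le_transfer //.
exact: GG_comp H _ _ _ _ gAB1 gAB.
Qed.

(* Near a point where [transfer] almost reaches its supremum, it is bounded below
   by a continuous derive_ratio; minimality moves this small oscillation everywhere. *)
Lemma transfer_continuous : continuous transfer.
Proof.
have [K K0 HK] := transfer_bounded.
pose V := range transfer.
have supV : has_sup V.
  by split; [exists (transfer 0), 0 | exists K => _ [x _ <-]].
move=> x; apply/continuous_distP => e e0.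
pose e' := e / (2 * K + 1).
have e'0 : 0 < e' by rewrite divr_gt0 //; lra.
have [_ [x1 _ <-] x1M] := sup_adherent e'0 supV.
set M := sup V in x1M.
have leM z : transfer z <= M by apply: (ub_le_sup supV.2); exists z.
have M_lt : M - e' < sup (ratios x1) by [].
have [_ [A1 [B1 [gAB1 ->]]] lt1] : exists2 r, ratios x1 r & M - e' < r.
  have h0 : 0 < sup (ratios x1) - (M - e') by rewrite subr_gt0.
  have [r hr] := sup_adherent h0 (ratios_has_sup x1).
  by rewrite opprB addrCA subrr addr0; exists r.
have g0 : 0 < derive_ratio A1 B1 x1 - (M - e') by rewrite subr_gt0.
have [d d0 dP] := (continuous_distP _ _).1 (@ratio_continuous _ _ gAB1 x1) _ g0.
have big z : `|z - x1| < d -> M - e' < transfer z.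
  move=> /dP; rewrite ltr_distl => /andP[+ _]; rewrite opprB addrCA subrr addr0.
  by move/lt_le_trans; apply; exact: ratio_le_transfer.
have [|A [B [gAB /andP[Ax1 Ax2]]]] := @GG_minimal _ _ _ H x (x1 - d) (x1 + d).
  lra.
have Axd : `|A x - x1| < d by rewrite ltr_distl Ax1.
have e1 : 0 < d - `|A x - x1| by rewrite subr_gt0.
have [dA _ _ _] := GG_C1 gAB.
have cA := is_derive1_continuous (derivable_is_derive1 (dA x)).
have [d1 d10 P1] := (continuous_distP _ _).1 cA _ e1.
have [d2 d20 P2] := (continuous_distP _ _).1 (@ratio_continuous _ _ gAB x) _ e'0.
exists (Num.min d1 d2); first by rewrite lt_min d10.
move=> y; rewrite lt_min => /andP[y1 y2].
have Ayd : `|A y - x1| < d.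
  by rewrite (le_lt_trans (ler_distD (A x) _ _)) // -ltrBrDr P1.
rewrite (transferE y gAB) (transferE x gAB).
have E (u v r s : R) : u * r - v * s = (u - v) * r + v * (r - s) by ring.
rewrite E.
apply: le_lt_trans (ler_normD _ _) _; rewrite [`|(_ - _) * _|]normrM [`|transfer _ * _|]normrM.
have b1 : `|transfer (A y) - transfer (A x)| <= e'.
  rewrite ler_distl lerBlDr; apply/andP; split.
    by apply: le_trans (leM _) _; rewrite -lerBlDr; exact: ltW (big _ Ayd).
  by apply: le_trans (leM _) _; rewrite -lerBlDr; exact: ltW (big _ Axd).
have b2 : `|derive_ratio A B y| <= K.
  by rewrite gtr0_norm ?ratio_gt0 // (le_trans (ratio_le_transfer y gAB)).
have b3 : `|transfer (A x)| <= K by rewrite gtr0_norm ?transfer_gt0.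
have b4 : `|derive_ratio A B y - derive_ratio A B x| <= e' by rewrite ltW // P2.
have h1 := ler_pM (normr_ge0 _) (normr_ge0 _) b1 b2.
have h2 := ler_pM (normr_ge0 _) (normr_ge0 _) b3 b4.
apply: le_lt_trans (lerD h1 h2) _.
have -> : e = e' * K + K * e' + e' by rewrite /e'; field; rewrite gt_eqF //; lra.
by rewrite ltrDl.
Qed.

Lemma transfer_periodic x : transfer (x + 1) = transfer x.
Proof.
rewrite (transferE x (GG_shift H)) -[LHS]mulr1; congr (_ * _).
have D z : derive1 (fun x : R => x + 1) z = 1.
  apply: is_derive1_val.
  by have := is_deriveD (is_derive_id z (1 : R)) (is_derive_cst (1 : R) z 1); rewrite addr0.
by rewrite /derive_ratio !D divr1.
Qed.

End transfer_function.
End conjugated_groups.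

(** * Comparison of the conjugacy with a primitive of the transfer function *)

Section derivative_of_conjugacy.
Variable R : realType.
Implicit Types (A B F U : R -> R) (x y : R).
Notation mu := (@lebesgue_measure R).

Lemma invSn_lt (e : R) : 0 < e -> exists i : nat, i.+1%:R^-1 < e.
Proof.
move=> e0; have [N _ /(_ N (leqnn N)) /= h] := near_infty_natSinv_lt (PosNum e0).
by exists N.
Qed.

(** Integrating from -1 makes every point of [[0, 1]], including 0, an interior point for the
    fundamental theorem of calculus. *)
Lemma antiderivative U : continuous U ->
  exists W : R -> R, forall x, -1 < x -> is_derive x 1 W (U x).
Proof.
move=> cU; exists (fun x => (\int[mu]_(t in `[(-1), x]) U t)%R) => x x1.
have [||d1 d2] := @continuous_FTC1_closed R U (-1) x (x + 1) _ _ x1 (cU x).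
- lra.
- apply: continuous_compact_integrable; first exact: segment_compact.
  exact: continuous_subspaceT.
by rewrite -[X in is_derive _ _ _ X]d2; exact: derivable_is_derive1.
Qed.

Definition steep F U (c : R) (i j : nat) : set R :=
  [set x | exists y, [/\ x < y, y < x + j.+1%:R^-1
                       & (c * U x + i.+1%:R^-1) * (y - x) < F y - F x]].

Lemma steep_open F U c i j : continuous F -> continuous U -> open (steep F U c i j).
Proof.
move=> cF cU; rewrite openE => x [y [xy yx lt]].
have c1 : {for x, continuous (fun z : R => y - z)}.
  by apply: cvgB; [exact: cvg_cst | exact: cvg_id].
have c2 : {for x, continuous (fun z : R => z + j.+1%:R^-1 - y)}.
  by apply: cvgB; [apply: cvgD; [exact: cvg_id | exact: cvg_cst] | exact: cvg_cst].
have c3 : {for x, continuous (fun z : R => F y - F z - (c * U z + i.+1%:R^-1) * (y - z))}.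
  apply: cvgB; first by apply: cvgB; [exact: cvg_cst | exact: cF].
  apply: cvgM; last exact: c1.
  by apply: cvgD; [apply: cvgM; [exact: cvg_cst | exact: cU] | exact: cvg_cst].
have n1 := near_continuous c1 (near_gt0 (_ : 0 < y - x)).
have n2 := near_continuous c2 (near_gt0 (_ : 0 < x + j.+1%:R^-1 - y)).
have n3 := near_continuous c3 (near_gt0 (_ : 0 < F y - F x - (c * U x + i.+1%:R^-1) * (y - x))).
rewrite !subr_gt0 in n1 n2 n3.
apply: filterS2 (n1 xy) (filterI (n2 yx) (n3 lt)) => z h1 [h2 h3].
by exists y; split; rewrite -subr_gt0.
Qed.

(** From [x] to [A x] both the Dini derivative of [F] and the threshold [c * U] are multiplied by
    [D2 / D1], the former because [F o A = B o F]. The margin shrinks, but a positive one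
    survives. *)
Lemma steep_transport A B F U (c D1 D2 x : R) :
  0 < c -> 0 < U x -> 0 < D1 -> 0 < D2 -> {homo A : x y / x < y} ->
  {homo F : x y / x < y} -> {for x, continuous F} ->
  (forall y, F (A y) = B (F y)) -> is_derive x 1 A D1 -> is_derive (F x) 1 B D2 ->
  U x * D2 = U (A x) * D1 ->
  (exists i, forall j, steep F U c i j x) -> exists i, forall j, steep F U c i j (A x).
Proof.
move=> c0 U0 D10 D20 hA hF cF conj dA dB EU [i Hi].
set de : R := i.+1%:R^-1 in Hi.
have de0 : 0 < de by rewrite invr_gt0.
pose u := c * U x; pose v := u * D2 / D1.
have u0 : 0 < u by rewrite mulr_gt0.
have v0 : 0 < v by rewrite divr_gt0 // mulr_gt0.
have vE : c * U (A x) = v.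
  have -> : v = c * (U x * D2) / D1 by rewrite /v /u !mulrA.
  by rewrite EU; field; rewrite gt_eqF.
pose s := u + de + v + 1.
have s0 : 0 < s by rewrite /s; lra.
(* The available slack is [D2 * de]. One half pays for the new margin [de'], the other for the
   linearisation error [e], whose coefficients add up to at most [s]. *)
have Dde : 0 < D2 * de by rewrite mulr_gt0.
pose e := Num.min (D2 / 2) (D2 * de / (2 * s)).
have e0 : 0 < e by rewrite lt_min !divr_gt0 // mulr_gt0.
have eD2 : e < D2.
  have : e <= D2 / 2 by rewrite ge_min lexx.
  lra.
have es : e * s <= D2 * de / 2.
  have h : e <= D2 * de / (2 * s) by rewrite ge_min lexx orbT.
  apply: le_trans (ler_wpM2r (ltW s0) h) _; rewrite le_eqVlt; apply/orP; left.
  by apply/eqP; field; rewrite gt_eqF.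
have d'0 : 0 < Num.min 1 (D2 * de / (2 * D1)).
  by rewrite lt_min ltr01 divr_gt0 // mulr_gt0.
have [i'] := invSn_lt d'0; rewrite lt_min => /andP[i1 i2].
exists i' => j'.
set de' : R := i'.+1%:R^-1 in i1 i2.
have de'0 : 0 < de' by rewrite invr_gt0.
have i3 : de' * D1 <= D2 * de / 2.
  move: i2; rewrite ltr_pdivlMr ?mulr_gt0 // => h.
  have -> : de' * D1 = de' * (2 * D1) / 2 by field.
  lra.
have cA := is_derive1_continuous dA.
have j'0 : 0 < j'.+1%:R^-1 :> R by rewrite invr_gt0.
have [d1 d10 P1] := (is_derive_distP _ _ _).1 dA _ e0.
have [d2 d20 P2'] := (is_derive_distP _ _ _).1 dB _ e0.
have [d3 d30 P3] := (continuous_distP _ _).1 cF _ d20.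
have [d4 d40 P4] := (continuous_distP _ _).1 cA _ j'0.
have dm : 0 < Num.min (Num.min d1 d3) d4 by rewrite !lt_min d10 d30.
have [j] := invSn_lt dm; rewrite !lt_min => /andP[/andP[j1 j3] j4].
have [y [xy yx lt]] := Hi j.
have h0 : 0 < y - x by rewrite subr_gt0.
have nyx : `|y - x| = y - x by rewrite gtr0_norm.
have yxj : y - x < j.+1%:R^-1 by rewrite ltrBlDl.
have hf : 0 < F y - F x by rewrite subr_gt0 hF.
have Axy := hA _ _ xy.
exists (A y); split => //.
  have := P4 y; rewrite nyx => /(_ (lt_trans yxj j4)).
  by rewrite ltr_distl => /andP[_].
rewrite !conj vE.
have a1 : A y - A x <= (D1 + e) * (y - x).
  have := P1 y; rewrite nyx => /(_ (lt_trans yxj j1)).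
  by rewrite ler_norml => /andP[_]; rewrite mulrDl lerBlDl.
have b1 : (D2 - e) * (F y - F x) <= B (F y) - B (F x).
  have := P2' (F y) (P3 y _); rewrite nyx => /(_ (lt_trans yxj j3)).
  rewrite (gtr0_norm hf) ler_norml => /andP[+ _]; rewrite mulrBl; lra.
apply: (@le_lt_trans _ _ ((v + de') * ((D1 + e) * (y - x)))).
  by apply: ler_wpM2l a1; rewrite addr_ge0 // ltW.
apply: lt_le_trans b1.
apply: (@le_lt_trans _ _ ((D2 - e) * ((u + de) * (y - x)))); last first.
  by rewrite ltr_pM2l // subr_gt0.
rewrite !mulrA ler_wpM2r ?(ltW h0) //.
have vD : v * D1 = u * D2 by rewrite /v; field; rewrite gt_eqF.
have e' : e * de' <= e by rewrite ler_piMr // ltW.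
have -> : (v + de') * (D1 + e) = v * D1 + de' * D1 + e * v + e * de' by ring.
have -> : (D2 - e) * (u + de) = u * D2 + D2 * de - e * u - e * de by ring.
have : e * s = e * u + e * de + e * v + e by rewrite /s; ring.
rewrite vD; lra.
Qed.

Section with_group.
Variables (al : R) (n : nat) (F Fi : R -> R) (GG : (R -> R) -> (R -> R) -> Prop).
Hypothesis H : conjugated_lifts al n F Fi GG.
Local Notation U := (transfer F GG).

Lemma steep_dichotomy c : 0 < c ->
  let E := \bigcup_i \bigcap_j steep F U c i j in
  measurable E /\ (mu (`[0, 1[ `&` E) = 0%E \/ mu (`[0, 1[ `\` E) = 0%E).
Proof.
move=> c0 E.
have cF := lift_continuous H; have cU := transfer_continuous H.
have oS i j : open (steep F U c i j) by apply: steep_open.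
have mE : measurable E.
  apply: bigcupT_measurable => i; apply: bigcapT_measurable => j.
  exact: open_measurable.
split => //.
have per i j x : steep F U c i j (x + 1) <-> steep F U c i j x.
  split=> -[y [xy yx lt]].
    exists (y - 1); split; [by rewrite ltrBrDr | by rewrite ltrBlDr addrAC |].
    have := lift_deg1 H (y - 1); rewrite subrK => Ey.
    move: lt; rewrite (transfer_periodic H) (lift_deg1 H) Ey.
    have -> : y - (x + 1) = y - 1 - x by ring.
    by rewrite opprD addrACA subrr addr0.
  exists (y + 1); split; [by rewrite ltrD2r | by rewrite addrAC ltrD2r |].
  rewrite (transfer_periodic H) !(lift_deg1 H).
  have -> : y + 1 - (x + 1) = y - x by ring.
  by have -> : F y + 1 - (F x + 1) = F y - F x by ring.
have inv A B : GG A B -> forall x, E x -> E (A x).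
  move=> gAB x [i _ Ex].
  have [dA _ dB _] := GG_C1 H gAB; have [A0 B0] := GG_derive_gt0 H gAB.
  have [hA _] := GG_homo H gAB.
  have [||i' Hi'] := @steep_transport A B F U c (derive1 A x) (derive1 B (F x)) x c0
    (transfer_gt0 H x) (A0 x) (B0 (F x)) hA (lift_homo H) (cF x) (GG_conj H gAB)
    (derivable_is_derive1 (dA x)) (derivable_is_derive1 (dB (F x))).
  - by rewrite (transferE H x gAB) /derive_ratio -mulrA divfK // gt_eqF.
  - by exists i => j; exact: Ex.
  by exists i' => // j _.
have [|h] := GG_ergodic H oS per inv; first by left.
right; have m01 : measurable (`[0, 1[%classic : set R) by [].
have m1 : mu (`[0, 1[%classic : set R) = 1%E.
  by rewrite lebesgue_measure_itv /= lte_fin ltr01 -EFinB subr0.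
have m1oo : (mu (`[0%R, 1%R[%classic : set R) < +oo)%E by rewrite m1 ltry.
apply: etrans (@measureD _ _ _ mu _ _ m01 mE m1oo) _.
apply: (@etrans _ _ (1 - 1)%E); last by rewrite subee.
by congr (_ - _)%E.
Qed.

Lemma conjugacy_derive : exists2 c, 0 < c & forall x, is_derive x 1 F (c * U x).
Proof.
have cF := lift_continuous H; have cU := transfer_continuous H.
have [W dW] := antiderivative cU.
have [K K0 HK] := transfer_bounded H; have [K1 K10 HF] := lift_lip H.
have WMVT s t : 0 <= s -> s <= t -> exists z, W t - W s = U z * (t - s).
  move=> s0 st.
  have [||z _ E] := @MVT_segment R W U s t st; last by exists z.
    by move=> z; rewrite in_itv /= => /andP[sz _]; apply: dW; lra.
  apply: derivable_within_continuous => z; rewrite in_itv /= => /andP[sz _].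
  by have [] := dW z ltac:(lra).
have W01 : 0 < W 1 - W 0.
  have [z ->] := WMVT 0 1 (lexx _) ler01; rewrite subr0 mulr1; exact: (transfer_gt0 H).
pose c := (W 1 - W 0)^-1; have c0 : 0 < c by rewrite invr_gt0.
pose P t := F t - c * W t.
have P01 : P 1 = P 0.
  have := lift_deg1 H 0; rewrite add0r /P => ->.
  have : c * (W 1 - W 0) = 1 by rewrite mulVf // gt_eqF.
  rewrite mulrBr; lra.
have W_lip s t : 0 <= s <= 1 -> 0 <= t <= 1 -> `|W s - W t| <= K * `|s - t|.
  have main u v : 0 <= u -> u <= v -> `|W v - W u| <= K * `|v - u|.
    move=> u0 uv; have [z ->] := WMVT _ _ u0 uv.
    by rewrite normrM ler_wpM2r // gtr0_norm ?HK // (transfer_gt0 H).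
  move=> /andP[s0 _] /andP[t0 _]; have [st|/ltW ts] := leP s t; last exact: main.
  by rewrite distrC [`|s - t|]distrC main.
have P_lip s t : 0 <= s <= 1 -> 0 <= t <= 1 -> `|P s - P t| <= (K1 + c * K) * `|s - t|.
  move=> s01 t01; rewrite /P opprD opprK addrACA mulrDl.
  rewrite (le_trans (ler_normD _ _)) // lerD ?HF // addrC -mulrBr normrM gtr0_norm //.
  by rewrite -mulrA ler_wpM2l ?(ltW c0) // distrC W_lip.
have L0 : 0 <= K1 + c * K by rewrite addr_ge0 ?mulr_ge0 // ltW.
have sub01 s t z : 0 <= s -> t <= 1 -> s <= z <= t -> 0 <= z <= 1.
  by move=> s0 t1 /andP[sz zt]; rewrite (le_trans s0) //= (le_trans zt).
have Wnear x e : 0 <= x -> 0 < e -> exists2 d, 0 < d &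
    forall y, x < y -> y < x + d -> `|c * (W y - W x) - c * U x * (y - x)| <= e * (y - x).
  move=> x0 e0; have ec0 : 0 < e / c by rewrite divr_gt0.
  have [d d0 dP] := (is_derive_distP _ _ _).1 (dW x ltac:(lra)) _ ec0.
  exists d => // y xy yd.
  have := dP y; rewrite gtr0_norm ?subr_gt0 // => /(_ ltac:(lra)).
  rewrite -mulrA -mulrBr normrM (gtr0_norm c0) => h.
  have -> : e * (y - x) = c * (e / c * (y - x)) by field; rewrite gt_eqF.
  by rewrite ler_wpM2l // ltW.
have [mE dicho] := steep_dichotomy c0.
set E := \bigcup_i _ in mE dicho.
have m01 : measurable (`[0, 1[%classic : set R) by [].
have P_cst t : 0 <= t <= 1 -> P t = P 0.
  move=> /andP[t0 t1].
  have incr : (forall s t, 0 <= s -> s <= t -> t <= 1 -> P s <= P t) \/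
              (forall s t, 0 <= s -> s <= t -> t <= 1 -> P t <= P s).
    (* If [E] is conull, [P] rises just to the right of almost every point and is nondecreasing; if
       [E] is null, [P] is nonincreasing. Either way [P 1 = P 0] forces it to be constant. *)
    case: dicho => mu0; [right|left] => {t0 t1}{}t s t0 ts s1; last first.
      apply: (@nondecreasing_ae R P t s (K1 + c * K) (`[0, 1[ `\` E)) => //.
      - by move=> u v uts vts; apply: P_lip; apply: sub01; eassumption.
      - exact: measurableD.
      - move=> x tx xs nNx d d0.
        have [i _ Ei] : E x.
          apply: contrapT => nE; apply: nNx; split => //=.
          by rewrite in_itv /= (le_trans t0) //= (lt_le_trans xs).
        have [p p0 Ep] : exists2 p : R, 0 < p & forall j : nat, exists y,
            [/\ x < y, y < x + j.+1%:R^-1 & (c * U x + p) * (y - x) < F y - F x].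
          by exists i.+1%:R^-1 => [|j]; [rewrite invr_gt0 | exact: Ei].
        have p20 : 0 < p / 2 by lra.
        have [d' d'0 d'P] := Wnear x _ (le_trans t0 tx) p20.
        have dm : 0 < Num.min d d' by rewrite lt_min d0.
        have [j] := invSn_lt dm; rewrite lt_min => /andP[jd jd'].
        have [y [xy yx lt]] := Ep j.
        have yd : y < x + d by rewrite (lt_trans yx) // ltrD2l.
        have yd' : y < x + d' by rewrite (lt_trans yx) // ltrD2l.
        exists y; split => //.
        have := d'P y xy yd'; rewrite ler_norml => /andP[_].
        have h0 : 0 < p * (y - x) by rewrite mulr_gt0 // subr_gt0.
        rewrite -subr_gt0 in lt; rewrite /P -subr_gt0.
        set X := F y - _ - _.
        have -> : X = (F y - F x - (c * U x + p) * (y - x)) -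
          (c * (W y - W x) - c * U x * (y - x)) + p * (y - x) by rewrite /X; ring.
        have -> : p / 2 * (y - x) = p * (y - x) / 2 by field.
        lra.
    (* Off [E] the Dini derivative is only known to be at most [c * U], so strict growth of [- P] is
       available only after adding a slope [e], which then tends to 0. *)
    apply/ler_addgt0Pr => e e0.
    have := @nondecreasing_ae R (fun z => e * z - P z) t s (e + (K1 + c * K))
      (`[0, 1[ `&` E) ts _ _ _ mu0.
    have eP : e * t - P t <= e * s - P s -> P s <= P t + e.
      have : e * (s - t) <= e by rewrite ler_piMr ?(ltW e0) //; lra.
      rewrite mulrBr; lra.
    move=> h; apply: eP; apply: h.
    + by rewrite addr_ge0 // ltW.
    + move=> u v uts vts.
      have -> : e * u - P u - (e * v - P v) = e * (u - v) - (P u - P v) by ring.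
      rewrite (le_trans (ler_normB _ _)) // mulrDl lerD //.
        by rewrite normrM gtr0_norm.
      by apply: P_lip; apply: sub01; eassumption.
    + exact: measurableI.
    + move=> x tx xs nNx d d0.
      have e20 : 0 < e / 2 by lra.
      have e40 : 0 < e / 4 by lra.
      have [i ie] := invSn_lt e20.
      have [j nj] : exists j, ~ steep F U c i j x.
        apply/existsNP => hall; apply: nNx; split; last by exists i.
        by rewrite /= in_itv /= (le_trans t0) //= (lt_le_trans xs).
      have [d' d'0 d'P] := Wnear x _ (le_trans t0 tx) e40.
      have j0 : 0 < j.+1%:R^-1 :> R by rewrite invr_gt0.
      pose m := Num.min (Num.min d d') j.+1%:R^-1.
      have m0 : 0 < m by rewrite !lt_min d0 d'0.
      have [md md' mj] : [/\ m <= d, m <= d' & m <= j.+1%:R^-1].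
        by rewrite /m !ge_min !lexx ?orbT.
      pose y := x + m / 2.
      have xy : x < y by rewrite /y; lra.
      exists y; split => //; first by rewrite /y; lra.
      have := d'P y xy ltac:(rewrite /y; lra); rewrite ler_norml => /andP[+ _].
      have h0 : 0 < y - x by rewrite subr_gt0.
      have Fle : F y - F x <= (c * U x + e / 2) * (y - x).
        apply: (@le_trans _ _ ((c * U x + i.+1%:R^-1) * (y - x))).
          rewrite leNgt; apply/negP => lt; apply: nj; exists y; split => //.
          by rewrite ltrD2l (lt_le_trans _ mj) //; lra.
        by rewrite ler_wpM2r ?(ltW h0) // lerD2l ltW.
      have eh : 0 < e * (y - x) by rewrite mulr_gt0.
      rewrite -subr_ge0 in Fle; rewrite -subr_ge0 /P -subr_gt0 => h.
      set X := _ - _.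
      have -> : X = ((c * U x + e / 2) * (y - x) - (F y - F x)) +
        (c * (W y - W x) - c * U x * (y - x) - - (e / 4 * (y - x))) + e * (y - x) / 4.
        by rewrite /X; field.
      lra.
  case: incr => incr; apply/eqP; rewrite eq_le.
    by apply/andP; split; [rewrite -P01 |]; apply: incr.
  by apply/andP; split; [|rewrite -P01]; apply: incr.
exists c => // x.
have inner (z : R) : 0 < z -> z < 1 -> is_derive z 1 F (c * U z).
  move=> z0 z1; have z1' : -1 < z by lra.
  apply: (@near_eq_is_derive _ _ _ (fun t => c * W t + P 0)).
    apply/near_distP; exists (Num.min z (1 - z)); first by rewrite lt_min z0 subr_gt0.
    move=> t; rewrite lt_min !ltr_distl => /andP[/andP[t0 _] /andP[_ t1]].
    have <- : P t = P 0 by apply: P_cst; apply/andP; split; lra.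
    by rewrite /P; ring.
  have := is_deriveD (is_deriveM (is_derive_cst c z (1 : R)) (dW z z1'))
    (is_derive_cst (P 0) z (1 : R)).
  by move/is_derive_eq; apply; rewrite /GRing.scale /= mulr0 addr0 addr0.
(* The formula is known only inside []0, 1[]. An element carrying [x] there, with [F = B' o F o A],
   extends it to [x], and [transferE] simplifies the chain rule to [c * U x]. *)
have [A [B [gAB /andP[A0 A1]]]] := GG_minimal H x ltr01.
have [A' [B' [gAB' AK _ BK _]]] := GG_inv H gAB.
have [dA _ dB _] := GG_C1 H gAB; have [dA' _ dB' _] := GG_C1 H gAB'.
have FE : F = B' \o (F \o A).
  by apply/funext => z /=; rewrite (GG_conj H gAB) BK.
have dFA := is_derive1_comp (inner _ A0 A1) (derivable_is_derive1 (dA x)).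
have := is_derive1_comp (derivable_is_derive1 (dB' ((F \o A) x))) dFA.
rewrite -FE => /is_derive_eq; apply.
have := derive1_cancel BK (dB (F x)) (dB' _).
rewrite /= (GG_conj H gAB) (transferE H x gAB) /derive_ratio => h.
have [_ B0] := GG_derive_gt0 H gAB.
apply: (mulIf (lt0r_neq0 (B0 (F x)))).
by rewrite mulrAC h mul1r; field; rewrite gt_eqF.
Qed.

End with_group.
End derivative_of_conjugacy.

(** * Bootstrap at a hyperbolic fixed point *)

Section regularity_of_conjugacy.
Variables (R : realType) (al : R) (n : nat).
Hypothesis al01 : 0 <= al <= 1.
Variables (F Fi : R -> R) (GG : (R -> R) -> (R -> R) -> Prop).
Hypothesis H : conjugated_lifts al n F Fi GG.
Implicit Types (A B : R -> R) (x y p : R).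
Local Notation U := (transfer F GG).

Lemma GG_iter A B m : GG A B -> GG (iter m A) (iter m B).
Proof.
by move=> gAB; elim: m => [|m IH]; [exact: GG_id H | exact: (GG_comp H gAB IH)].
Qed.

Lemma GG_continuous A B : GG A B -> continuous A.
Proof.
move=> gAB x; have [dA _ _ _] := GG_C1 H gAB.
exact: is_derive1_continuous (derivable_is_derive1 (dA x)).
Qed.

Lemma GG_le A B : GG A B -> {homo A : x y / x <= y}.
Proof.
move=> /(GG_homo H)[hA _] x y; rewrite le_eqVlt => /predU1P[->//|/hA/ltW //].
Qed.

Lemma GG_degn A B m x : GG A B -> A (x + m%:R) = A x + m%:R.
Proof.
move=> gAB; have [dA _] := GG_deg1 H gAB.
elim: m => [|m IH]; first by rewrite !addr0.
by rewrite -natr1 !addrA dA IH.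
Qed.

(* Iterates of an element with a fixed point shrink a fundamental interval; two
   elements sending the limit point into each half give a ping-pong pair. *)
Lemma hyperbolic_fixed_point : exists A B p, [/\ GG A B, A p = p & derive1 A p < 1].
Proof.
have [A0 [B0 [g0 [z Az] [x Ax]]]] := GG_nonfree H.
wlog {Ax} Ax : A0 B0 g0 Az / x < A0 x.
  move=> W; have [h|h] := ltP x (A0 x); first exact: (W A0 B0).
  have [A' [B' [g' AK A'K _ _]]] := GG_inv H g0.
  apply: (W A' B') => //; first by rewrite -{1}Az AK.
  have [hA' _] := GG_homo H g'.
  by rewrite -{1}(AK x); apply: hA'; rewrite lt_neqAle h andbT; apply/eqP.
pose u m := iter m A0 x.
have u_incr : {homo u : m k / (m <= k)%N >-> m <= k}.
  apply: homo_leq => [//|a b c|m]; [exact: le_trans | rewrite /u].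
  elim: m => [|m IH]; [exact: ltW | exact: (GG_le g0 IH)].
(* Integer translates of the fixed point [z] are fixed too; one of them to the right of [x] bounds
   the orbit of [x]. *)
pose N := (Num.truncn (x - z)).+1.
have xN : x <= z + N%:R by rewrite -lerBlDl ltW // truncnS_gt.
have uN m : u m <= z + N%:R.
  elim: m => [//|m IH]; rewrite /u iterS (le_trans (GG_le g0 IH)) //.
  by rewrite (GG_degn _ _ g0) Az.
pose V := range u.
have supV : has_sup V by split; [exists (u 0), 0 | exists (z + N%:R) => _ [m _ <-]].
pose l := sup V.
have ul m : u m <= l by apply: (ub_le_sup supV.2); exists m.
have near_l (d : R) : 0 < d -> exists m, forall k, (m <= k)%N -> `|u k - l| < d.
  move=> d0; have [_ [m _ <-] um] := sup_adherent d0 supV.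
  exists m => k mk; rewrite ler0_norm ?subr_le0 // opprB.
  by have := u_incr _ _ mk; rewrite -/l in um; lra.
have goto a b : a < b -> exists h h' m, GG h h' /\
    forall k, (m <= k)%N -> a < h (u k) < b.
  move=> ab; have [h [h' [gh /andP[ah hb]]]] := GG_minimal H l ab.
  have e0 : 0 < Num.min (h l - a) (b - h l) by rewrite lt_min !subr_gt0 ah.
  have [d d0 dP] := (continuous_distP _ _).1 (@GG_continuous _ _ gh l) _ e0.
  have [m mP] := near_l d d0; exists h, h', m; split => // k /mP/dP.
  by rewrite lt_min !ltr_distl => /andP[/andP[? _] /andP[_ ?]]; apply/andP; split; lra.
set y := A0 x in Ax *.
pose c := (x + y) / 2.
have [|h1 [h1' [m1 [g1 P1]]]] := goto x c; first by rewrite /c; lra.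
have [|h2 [h2' [m2 [g2 P2]]]] := goto c y; first by rewrite /c; lra.
pose m := maxn m1 m2.
pose phi b := if b then h1 \o iter m A0 else h2 \o iter m A0.
pose phi' b := if b then h1' \o iter m B0 else h2' \o iter m B0.
have gphi b : GG (phi b) (phi' b).
  by case: b; [apply: (GG_comp H g1) | apply: (GG_comp H g2)]; exact: GG_iter.
(* As [y = A0 x], the map [iter m A0] sends [x] and [y] to two consecutive terms of the orbit, both
   close to [l], so that [h1] and [h2] put the image of [[x, y]] into its left and right half. *)
have um : iter m A0 x = u m by [].
have um1 : iter m A0 y = u m.+1 by rewrite /u /y -iterSr.
have [mm1 mm2] : (m1 <= m)%N /\ (m2 <= m)%N by rewrite leq_maxl leq_maxr.
have /andP[a1 b1] := P1 m mm1; have /andP[a2 b2] := P1 m.+1 (leqW mm1).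
have /andP[a3 b3] := P2 m mm2; have /andP[a4 b4] := P2 m.+1 (leqW mm2).
have phi_itv b t : x <= t <= y -> x <= phi b t <= y.
  move=> /andP[xt ty].
  have := GG_le (gphi b) xt; have := GG_le (gphi b) ty.
  case: b; rewrite /= um um1 => h h'; apply/andP; split;
    rewrite /c in b1 b2 a3 a4 *; lra.
have phi_disj : phi true y < phi false x by rewrite /= um um1 (lt_trans b2).
have hom b : {homo phi b : s t / s < t} by have [] := GG_homo H (gphi b).
have der b t : derivable (phi b) t 1 by have [] := GG_C1 H (gphi b).
have cont b : continuous (derive1 (phi b)) by have [] := GG_C1 H (gphi b).
have pos b t : 0 < derive1 (phi b) t by have [] := GG_derive_gt0 H (gphi b).
have [w [p [_ wp wd]]] := ping_pong_hyperbolic Ax hom phi_itv phi_disj der cont pos.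
have [B gw] : exists B, GG (word phi w) B.
  elim: (w) => [|b v [B IH]]; first by exists id; exact: GG_id H.
  by exists (phi' b \o B); exact: (GG_comp H (gphi b) IH).
by exists (word phi w), B, p.
Qed.

Lemma C1_contraction A p : (forall x, derivable A x 1) -> continuous (derive1 A) ->
  (forall x, 0 < derive1 A x) -> derive1 A p < 1 ->
  exists d rho, [/\ 0 < d, 0 <= rho < 1 &
    forall s t, `|s - p| < d -> `|t - p| < d -> `|A s - A t| <= rho * `|s - t|].
Proof.
move=> dA cA A0 A1.
have e0 : 0 < (1 - derive1 A p) / 2 by lra.
have [d d0 dP] := (continuous_distP _ _).1 (cA p) _ e0.
exists d, (derive1 A p + (1 - derive1 A p) / 2); split => //.
  by have := A0 p => ?; apply/andP; split; lra.
move=> s t sd td.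
have [||c [cd _ _ ->]] := @MVT_dist R A p d s t (fun y _ => dA y) => //.
rewrite normrM ler_wpM2r // gtr0_norm //.
by have := dP _ cd; rewrite ltr_distl => /andP[_ /ltW]; rewrite addrC.
Qed.

Lemma conjugacy_regular : forall x, Cr_at al n.+1 F x.
Proof.
have [c c0 dF] := conjugacy_derive H.
have [A [B [p [gAB Ap Ap1]]]] := hyperbolic_fixed_point.
have [dA cA dB cB] := GG_C1 H gAB; have [A0 B0] := GG_derive_gt0 H gAB.
have [rA rB] := GG_reg H gAB; have [hA _] := GG_homo H gAB.
have cU := transfer_continuous H.
have [d [rho [d0 r01 ctr]]] := C1_contraction dA cA A0 Ap1.
have [K K0 lipF] := lift_lip H.
have lipFp x : lipschitz_at F x by exists K, 1; split => //; exact: ltW.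
(* This is [ln F']; in [yE] the composite [y o A] has coefficient 1, the extreme value permitted by
   [Cr_at_cohomology]. *)
pose y x := ln (c * U x).
pose b x := ln (derive1 A x) - ln (derive1 B (F x)).
have cU0 x : 0 < c * U x by rewrite mulr_gt0 // (transfer_gt0 H).
have yE s : y s = 1 * y (A s) + b s.
  rewrite /y /b mul1r (transferE H s gAB) /derive_ratio !mulrA.
  by rewrite ln_div ?posrE ?mulr_gt0 ?invr_gt0 ?(transfer_gt0 H) // lnM ?posrE ?addrA.
have cy s : {for s, continuous y}.
  apply: continuous_comp; last exact: continuous_ln.
  by apply: cvgM; [exact: cvg_cst | exact: cU].
have inj s t : A s = A t -> s = t.
  by move=> E; have [/hA|/hA|//] := ltgtP s t; rewrite E ltxx.
(* Each turn gains one derivative: [F] of class [m] makes [b], then [y], then [F' = exp y] of class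
   [m]. Composing the derivative of [B] with [F] loses no Hoelder exponent because [F] is
   Lipschitz. *)
have Fp : forall m, (m <= n.+1)%N -> Cr_at al m F p.
  elim=> [_|m IH mn].
    apply: (Cr_at0_C1 al01); first by apply: filterE => x; case: (dF x).
    apply: filterE => x; have -> : derive1 F = (fun t => c * U t).
      by apply/funext => t; exact: is_derive1_val.
    by apply: cvgM; [exact: cvg_cst | exact: cU].
  have hF : Cr_at al m F p by apply: IH; exact: ltnW.
  have hA' : Cr_at al m (derive1 A) p by apply: (Cr_at_le al01 mn (rA p)).2.
  have hB' : Cr_at al m (derive1 B) (F p) by apply: (Cr_at_le al01 mn (rB (F p))).2.
  have hb : Cr_at al m b p.
    have h1 : Cr_at al m (@ln R \o derive1 A) p.
      by apply: Cr_at_comp_smooth => //; exact: Cr_at_ln.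
    have h2 : Cr_at al m (@ln R \o (derive1 B \o F)) p.
      apply: Cr_at_comp_smooth => //; last exact: Cr_at_comp.
      by apply: Cr_at_ln => //=.
    exact: (Cr_atB al01 h1 h2).
  have hy : Cr_at al m y p.
    apply: (@Cr_at_cohomology _ _ al01 m A y (fun=> 1) b p d rho) => //.
    - by move=> s t _ _; exact: inj.
    - by move=> s _; rewrite normr1.
    - exact: (Cr_at_le al01 (ltnW mn) (rA p)).
    - exact: Cr_at_cst.
  apply: (@Cr_atS_intro _ _ _ _ (expR \o y)).
    by apply: filterE => x; rewrite /= /y lnK ?posrE //; exact: dF.
  exact: (@Cr_at_comp_smooth R al al01 m expR y p (Cr_at_expR al01 _ _) hy).
move=> x.
have [e e0 eP] := (near_distP _ _).1 (Cr_at_near (Fp _ (leqnn _))).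
have pe : p - e < p + e by lra.
have [A1 [B1 [g1 /andP[h1 h2]]]] := GG_minimal H x pe.
have [A1' [B1' [g1' AK _ BK _]]] := GG_inv H g1.
have FE : F = B1' \o (F \o A1).
  by apply/funext => t /=; rewrite (GG_conj H g1) BK.
have [r1 _] := GG_reg H g1; have [_ r1'] := GG_reg H g1'.
have hFA : Cr_at al n.+1 (F \o A1) x.
  apply: Cr_at_comp => //; last exact: Cr_at_lipschitz (r1 x).
  by apply: eP; rewrite ltr_distl h1.
rewrite FE; apply: Cr_at_comp => //.
exact: Cr_at_lipschitz hFA.
Qed.

End regularity_of_conjugacy.

(** * Passage between local classes and the global condition [Cr_fun] *)

Section global_regularity.
Variable R : realType.
Implicit Types (f F : R -> R) (x y al : R).

Lemma derive1n_Cr_at al n f : 0 <= al ->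
  (forall i, (i < n)%N -> forall t, derivable (derive1n i f) t 1) ->
  continuous (derive1n n f) ->
  (0 < al -> exists C, forall s t, `|derive1n n f s - derive1n n f t| <= C * `|s - t| `^ al) ->
  forall x, Cr_at al n f x.
Proof.
move=> al0; elim: n f => [|n IH] f df cf hf x.
  split; first exact: filterE.
  have := al0; rewrite le_eqVlt => /predU1P[<-|/hf [C HC]].
    have [d d0 dP] := (continuous_distP _ _).1 (cf x) _ ltr01.
    exists 2, d; split => // s t sx tx; rewrite powRr0 mulr1.
    rewrite (le_trans (ler_distD (f x) _ _)) // [`|f x - _|]distrC.
    by have := dP _ sx; have := dP _ tx; lra.
  exists `|C|, 1; split => // s t _ _.
  by rewrite (le_trans (HC s t)) // ler_wpM2r ?powR_ge0 // ler_norm.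
split; first by apply: filterE => y; exact: (df 0).
apply: IH => [i ni t||/hf]; rewrite -?derive1Sn //.
exact: df.
Qed.

Lemma Cr_at_derive1n al n f : (forall x, Cr_at al n f x) ->
  [/\ forall i, (i < n)%N -> forall t, derivable (derive1n i f) t 1,
      continuous (derive1n n f) & forall x, holder_at al (derive1n n f) x].
Proof.
elim: n f => [|n IH] f hf.
  split => // x; first exact: Cr_at_continuous (hf x).
  by have [] := hf x.
have [d c h] := IH (derive1 f) (fun x => (hf x).2).
split => [[_|i ni] t|x|x]; rewrite ?derive1Sn; [|exact: d|exact: c|exact: h].
by have [/nbhs_singleton] := hf t.
Qed.

Lemma derive1_deg f c : (forall x, f (x + 1) = f x + c) ->
  forall x, derive1 f (x + 1) = derive1 f x.
Proof.
move=> fE x; rewrite /derive1.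
suff -> : (fun h => h^-1 *: (f (h + (x + 1)) - f (x + 1))) =
  (fun h => h^-1 *: (f (h + x) - f x)) by [].
by apply/funext => h; rewrite addrA !fE opprD addrACA subrr addr0.
Qed.

Lemma derive1n_deg n f c : (forall x, f (x + 1) = f x + c) ->
  forall x, derive1n n.+1 f (x + 1) = derive1n n.+1 f x.
Proof.
elim: n f c => [|n IH] f c fE x; first by rewrite derive1n1; exact: derive1_deg fE x.
rewrite derive1Sn; apply: (IH _ 0) => y; rewrite addr0; exact: derive1_deg fE y.
Qed.

Lemma periodic_int (T : Type) (f : R -> T) (m : int) : (forall x, f (x + 1) = f x) ->
  forall x, f (x + m%:~R) = f x.
Proof.
move=> fE; have fn (k : nat) x : f (x + k%:R) = f x.
  by elim: k => [|k IH]; [rewrite addr0 | rewrite -natr1 addrA fE].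
move=> x; case: m => k; first by rewrite -pmulrn.
by rewrite NegzE mulrNz -(fn k.+1) -pmulrn subrK.
Qed.

(** The interval [[0, 2]] suffices: for [s <= t], lowering [t] by the integer part of [t - s] brings
    it within 1 of [s] without increasing the distance, and a common translation puts [s] in [[0,
    1[]. *)
Lemma periodic_holder al f : 0 <= al -> (forall x, f (x + 1) = f x) ->
  (forall x, holder_at al f x) ->
  exists C, forall s t, `|f s - f t| <= C * `|s - t| `^ al.
Proof.
move=> al0 per hol.
pose P u v := exists2 C, 0 <= C & forall s t, u <= s <= v -> u <= t <= v ->
  `|f s - f t| <= C * `|s - t| `^ al.
have sym C u v : (forall s t, u <= s -> s <= t -> t <= v ->
    `|f s - f t| <= C * `|s - t| `^ al) ->
  forall s t, u <= s <= v -> u <= t <= v -> `|f s - f t| <= C * `|s - t| `^ al.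
  move=> h s t /andP[us sv] /andP[ut tv]; have [st|/ltW ts] := leP s t; first exact: h.
  by rewrite distrC [`|s - t|]distrC h.
have [C C0 HC] : P 0 2.
  apply: (@interval_induction _ P); last lra.
    move=> x; have [C [d [C0 d0 HC]]] := hol x.
    exists d => // u v xu uv vx; exists C => // s t /andP[us sv] /andP[ut tv].
    by apply: HC; rewrite ltr_distl; apply/andP; split; lra.
  move=> a u v w au uv vw [C1 C10 H1] [C2 C20 H2].
  exists (C1 + C2); first exact: addr_ge0.
  apply: sym => s t as_ st tw.
  have pw := powR_ge0 `|s - t| al.
  have [tv|vt] := leP t v.
    rewrite (le_trans (H1 s t _ _)) ?ler_wpM2r ?lerDl //; apply/andP; split => //; lra.
  have [sv|vs] := leP s v; last first.
    by rewrite (le_trans (H2 s t _ _)) ?ler_wpM2r ?lerDr //; apply/andP; split; lra.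
  rewrite (le_trans (ler_distD (f v) _ _)) // mulrDl lerD //.
    rewrite (le_trans (H1 s v _ _)) ?ler_wpM2l ?ge0_ler_powR ?nnegrE //;
      try by apply/andP; split; lra.
    by rewrite !ler0_norm; lra.
  rewrite (le_trans (H2 v t _ _)) ?ler_wpM2l ?ge0_ler_powR ?nnegrE //;
    try by apply/andP; split; lra.
  by rewrite !ler0_norm; lra.
exists C => s t; wlog st : s t / s <= t.
  by move=> W; have [/W//|/ltW/W] := leP s t; rewrite distrC [`|t - s|]distrC.
pose m := Num.floor s; pose k := Num.floor (t - s).
have /andP[m1 m2] := floor_itv s; have /andP[k1 k2] := floor_itv (t - s).
rewrite -/m -/k in m1 m2 k1 k2.
have k0 : 0 <= k%:~R :> R by rewrite ler0z floor_ge0 subr_ge0.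
have Es : f s = f (s - m%:~R) by rewrite -{1}(subrK m%:~R s) periodic_int.
have Et : f t = f (t - k%:~R - m%:~R).
  by rewrite -{1}(subrK k%:~R t) -{1}(subrK m%:~R (t - _)) !periodic_int.
rewrite Es Et.
rewrite (le_trans (HC _ _ _ _)) ?ler_wpM2l ?ge0_ler_powR ?nnegrE //;
  try by apply/andP; split; rewrite ?rmorphD /= in m2 k2; lra.
rewrite !ler0_norm; lra.
Qed.

Lemma Cr_at_Cr_fun r n F : Num.truncn r = n.+1 -> 0 <= r - n.+1%:R ->
  (forall x, F (x + 1) = F x + 1) ->
  (forall x, Cr_at (r - n.+1%:R) n.+1 F x) -> Cr_fun r F.
Proof.
move=> rn al0 deg hF; have [d c h] := Cr_at_derive1n hF.
rewrite /Cr_fun rn; split => // _.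
by apply: periodic_holder => //; exact: derive1n_deg deg.
Qed.

End global_regularity.

(** * Lifts of circle maps *)

Section circle_lifts.
Variable R : realType.
Implicit Types (A B F : R -> R) (x y s t : R) (f g : circle R -> circle R).

Local Notation pr := (@circle_proj R).

Lemma circle_projP s t : pr s = pr t <-> exists m : int, s = t + m%:~R.
Proof.
have -> : (pr s = pr t) <-> (s - t \is a Num.int).
  by split=> [/(@eqmodP R (eqmod1_equiv R) s t)|h]; last exact/(@eqmodP R (eqmod1_equiv R) s t).
split=> [/intrP[m E]|[m ->]]; first by exists m; rewrite -E addrC subrK.
by rewrite addrC addKr; apply/intrP; exists m.
Qed.

Lemma circle_projD t (m : int) : pr (t + m%:~R) = pr t.
Proof. by apply/circle_projP; exists m. Qed.

Lemma circle_proj_surj (z : circle R) : exists t, pr t = z.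
Proof. by exists (repr z); rewrite /circle_proj reprK. Qed.

Lemma circle_openE (V : set (circle R)) : open V = open (pr @^-1` V).
Proof. by []. Qed.

Lemma circle_dist_le s t : circle_dist (pr s) (pr t) <= `|s - t|.
Proof.
apply: ge_inf; last by exists s, t.
by exists 0 => _ [s' [t' [_ _ ->]]].
Qed.

(** Other representatives change [s - t] by a nonzero integer, hence have distance at least 1 -
    1/2. *)
Lemma circle_dist_ge s t : `|s - t| <= 1 / 2 -> `|s - t| <= circle_dist (pr s) (pr t).
Proof.
move=> st; apply: lb_le_inf; first by exists `|s - t|, s, t.
move=> _ [s' [t' [/circle_projP[m ->] /circle_projP[k ->] ->]]].
have -> : s + m%:~R - (t + k%:~R) = (s - t) + (m - k)%:~R by rewrite rmorphB /=; ring.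
have [->|mk] := eqVneq (m - k) 0; first by rewrite addr0.
have h1 : 1 <= `|(m - k)%:~R| :> R by rewrite -intr_norm -[1]/(1%:~R) ler_int -gtz0_ge1 normr_gt0.
have := ler_normB ((s - t) + (m - k)%:~R) (s - t).
rewrite [X in `|X| <= _]addrAC subrr add0r; lra.
Qed.

Lemma int_valued_const (D : R -> R) : continuous D -> (forall t, D t \is a Num.int) ->
  forall s t, D s = D t.
Proof.
move=> cD iD; pose P u v := forall s t, u <= s <= v -> u <= t <= v -> D s = D t.
have H : forall a b, a <= b -> P a b.
  apply: interval_induction => [x|a u v w au uv vw Pav Puw s t sb tb].
    have h2 : 0 < 1 / 2 :> R by lra.
    have [d d0 dP] := (continuous_distP _ _).1 (cD x) _ h2.
    exists d => // u v xu uv vx s t /andP[us sv] /andP[ut tv].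
    have Ds := dP s ltac:(by rewrite ltr_distl; apply/andP; split; lra).
    have Dt := dP t ltac:(by rewrite ltr_distl; apply/andP; split; lra).
    have : `|D s - D t| < 1.
      rewrite (le_lt_trans (ler_distD (D x) _ _)) // [`|D x - _|]distrC; lra.
    have /intrP[m E] : D s - D t \is a Num.int by rewrite rpredB.
    rewrite E -intr_norm -[1]/(1%:~R) ltr_int => m1.
    have m0 : m = 0 by move: m1; case: (m) => [[|?]|?].
    by apply/eqP; rewrite -subr_eq0 E m0.
  have Dv z : a <= z <= w -> D z = D v.
    move=> /andP[az zw]; have [zv|vz] := leP z v.
      by apply: Pav; apply/andP; split => //; lra.
    by apply: Puw; apply/andP; split => //; lra.
  by rewrite !Dv.
by move=> s t; have [st|/ltW ts] := leP s t;
  [apply: (H s t) | apply: (H t s)] => //; rewrite ?lexx ?st ?ts.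
Qed.

Lemma lift_unique f A B : continuous A -> continuous B -> circle_lift f A ->
  circle_lift f B -> exists m : int, forall t, A t = B t + m%:~R.
Proof.
move=> cA cB lA lB.
have iD t : A t - B t \is a Num.int.
  have /circle_projP[m ->] : pr (A t) = pr (B t) by rewrite -lA lB.
  by rewrite addrC addKr; apply/intrP; exists m.
have cD : continuous (fun t => A t - B t) by move=> t; apply: cvgB; [exact: cA | exact: cB].
have /intrP[m E] := iD 0; exists m => t.
by rewrite -E -(int_valued_const cD iD t 0) addrC subrK.
Qed.

Lemma lift_shift f A (m : int) : circle_lift f A -> circle_lift f (fun t => A t + m%:~R).
Proof. by move=> lA t; rewrite lA circle_projD. Qed.

(** The degree [m] is positive since [A] increases. If it were 2 or more, [A] would take the value
    [A 0 + 1] strictly between 0 and 1, against the injectivity of [f]. *)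
Lemma lift_deg1_homeo f A : injective f -> continuous A -> {homo A : x y / x < y} ->
  circle_lift f A -> forall t, A (t + 1) = A t + 1.
Proof.
move=> fi cA hA lA.
have cA1 : continuous (fun t => A (t + 1)).
  move=> t; apply: continuous_comp; last exact: cA.
  by apply: cvgD; [exact: cvg_id | exact: cvg_cst].
have lA1 : circle_lift f (fun t => A (t + 1)).
  by move=> t; rewrite -lA -[X in t + X](mulr1z 1) circle_projD.
have [m mE] := lift_unique cA1 cA lA1 lA.
have m0 : 0 < m.
  rewrite -(ltr_int R) -(ltrD2l (A 0)) -mE addr0; apply: hA; lra.
suff m1 : ~~ (1 < m).
  have mE1 : m = 1 by apply/eqP; rewrite eq_le leNgt m1 /= -gtz0_ge1.
  by move=> t; rewrite mE mE1.
apply/negP => m1.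
have cA01 : {within `[0, 1], continuous A} by exact: continuous_subspaceT.
have m2 : (1 + 1 : R) <= m%:~R by rewrite -[1 + 1]/((1 + 1)%:~R) ler_int -ltzD1 ltrD2r.
have [|s] := @IVT R A 0 1 (A 0 + 1) ler01 cA01.
  have := mE 0; rewrite add0r => ->.
  by rewrite ge_min le_max; apply/andP; split; apply/orP; [left|right]; lra.
rewrite in_itv /= => /andP[s0 s1] As.
have /circle_projP[k kE] : pr s = pr 0.
  by apply: fi; rewrite !lA As -[X in _ + X](mulr1z 1) circle_projD.
have s00 : s != 0 by apply/eqP => s0'; move: As; rewrite s0'; lra.
have s11 : s != 1.
  by apply/eqP => s1'; move: As; have := mE 0; rewrite add0r s1' => ->; lra.
have k0 : 0 < k by rewrite -(ltr_int R) -[k%:~R]add0r -kE lt_neqAle eq_sym s00.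
have k1 : k < 1 by rewrite -(ltr_int R) -[k%:~R]add0r -kE lt_neqAle s11.
by move: k0; rewrite gtz0_ge1 leNgt k1.
Qed.

(** Circle distance and distance in [R] agree at small scale, where continuity of [F] confines both
    values; the local constant is the same everywhere, so it survives glueing. *)
Lemma lift_lipschitz f F : continuous F -> circle_lift f F -> circle_lipschitz f ->
  exists2 K, 0 < K & forall x y, `|F x - F y| <= K * `|x - y|.
Proof.
move=> cF lF [k Hk]; exists (`|k| + 1) => [|x y]; first by rewrite ltr_wpDl.
pose P u v := forall s t, u <= s -> s <= t -> t <= v -> `|F s - F t| <= (`|k| + 1) * `|s - t|.
have H : forall a b, a <= b -> P a b.
  apply: interval_induction => [z|a u v w au uv vw Pav Puw s t as_ st tw].
    have h4 : 0 < 1 / 4 :> R by lra.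
    have [d d0 dP] := (continuous_distP _ _).1 (cF z) _ h4.
    exists d => // u v xu uv vx s t us st tv.
    have Ds := dP s ltac:(by rewrite ltr_distl; apply/andP; split; lra).
    have Dt := dP t ltac:(by rewrite ltr_distl; apply/andP; split; lra).
    have : `|F s - F t| <= 1 / 2.
      rewrite (le_trans (ler_distD (F z) _ _)) // [`|F z - _|]distrC; lra.
    move=> /circle_dist_ge /le_trans; apply; rewrite -!lF (le_trans (Hk _ _)) //.
    apply: (@le_trans _ _ (`|k| * circle_dist (pr s) (pr t))).
      rewrite ler_wpM2r ?ler_norm //.
      apply: lb_le_inf; first by exists `|s - t|, s, t.
      by move=> _ [s' [t' [_ _ ->]]].
    rewrite (le_trans (ler_wpM2l (normr_ge0 k) (circle_dist_le s t))) //.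
    by rewrite ler_wpM2r // lerDl.
  have [tv|vt] := leP t v; first exact: Pav.
  have [sv|vs] := leP s v; last by apply: Puw => //; lra.
  rewrite (le_trans (ler_distD (F v) _ _)) //.
  rewrite (le_trans (lerD (Pav s v as_ sv (lexx _)) (Puw v t (ltW uv) (ltW vt) tw))) //.
  by rewrite -mulrDr ler_wpM2l ?addr_ge0 // !ler0_norm; lra.
have [xy|/ltW yx] := leP x y; first exact: (H x y).
by rewrite distrC [`|x - y|]distrC; exact: (H y x).
Qed.

Lemma incr_deg1_inverse F : continuous F -> {homo F : x y / x < y} ->
  (forall t, F (t + 1) = F t + 1) -> exists Fi,
  [/\ cancel F Fi, cancel Fi F, {homo Fi : x y / x < y} & continuous Fi].
Proof.
move=> cF hF dF.
have Fn (m : nat) t : F (t + m%:R) = F t + m%:R.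
  by elim: m => [|m IH]; [rewrite !addr0 | rewrite -natr1 !addrA dF IH].
have Finj s t : F s = F t -> s = t.
  by move=> E; have [/hF|/hF|//] := ltgtP s t; rewrite E ltxx.
have Fsurj y : exists x, F x = y.
  pose m := (Num.truncn `|y - F 0|).+1.
  have mP : `|y - F 0| < m%:R := truncnS_gt _.
  have h1 : F 0 + m%:R = F m%:R by rewrite -Fn add0r.
  have h2 : F (- m%:R) = F 0 - m%:R.
    by have := Fn m (- m%:R); rewrite addNr => ->; rewrite addrK.
  have mm : - m%:R <= m%:R :> R by rewrite (@le_trans _ _ 0) // oppr_le0.
  have cw : {within `[(- m%:R), m%:R], continuous F} by exact: continuous_subspaceT.
  have [|x _ <-] := @IVT R F (- m%:R) m%:R y mm cw; last by exists x.
  move: mP; rewrite ltr_distl -h1 -h2 => /andP[? ?].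
  by rewrite ge_min le_max; apply/andP; split; apply/orP; [left|right]; lra.
have [Fi FiK] := choice Fsurj.
have FK : cancel F Fi by move=> x; apply: Finj; rewrite FiK.
have hFi : {homo Fi : x y / x < y}.
  move=> x y xy; rewrite ltNge; apply/negP; rewrite le_eqVlt => /predU1P[E|/hF].
    by move: xy; rewrite -(FiK x) -(FiK y) E ltxx.
  by rewrite !FiK; move/(lt_trans xy); rewrite ltxx.
exists Fi; split => // y.
apply/continuous_distP => e e0; set x := Fi y.
have l1 : F (x - e) < y by rewrite -(FiK y); apply: hF; rewrite -/x; lra.
have l2 : y < F (x + e) by rewrite -{1}(FiK y); apply: hF; rewrite -/x; lra.
exists (Num.min (y - F (x - e)) (F (x + e) - y)); first by rewrite lt_min !subr_gt0 l1.
move=> z; rewrite lt_min !ltr_distl => /andP[/andP[z1 _] /andP[_ z2]].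
apply/andP; split.
  by rewrite -(FK (x - e)); apply: hFi; lra.
by rewrite -(FK (x + e)); apply: hFi; lra.
Qed.

End circle_lifts.

(** * From the two actions to the group of matched lifts *)

Section good_lifts.
Variables (R : realType) (r : R) (n : nat).
Hypothesis rn : Num.truncn r = n.+1.
Hypothesis al01 : 0 <= r - n.+1%:R <= 1.
Implicit Types (A B F : R -> R) (x y s t : R) (f : circle R -> circle R).
Local Notation pr := (@circle_proj R).
Local Notation al := (r - n.+1%:R).
Notation mu := (@lebesgue_measure R).

Definition good_lift f A : Prop := [/\ circle_lift f A, {homo A : x y / x < y},
  forall x, A (x + 1) = A x + 1 & forall x, Cr_at al n.+1 A x].

Lemma good_lift_continuous f A : good_lift f A -> continuous A.
Proof. by move=> [_ _ _ h] x; exact: Cr_at_continuous (h x). Qed.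

(** The hypotheses provide one smooth lift and one increasing lift. They differ by an integer
    constant, so the smooth one is increasing as well. *)
Lemma good_lift_exists f : Cr_diffeo r f -> orientation_preserving f ->
  exists A, good_lift f A.
Proof.
move=> [f' [[fK _ _ _] [A [lA crA]] _]] [A1 [cA1 hA1 lA1]].
have [al0 _] := andP al01.
have hA x : Cr_at al n.+1 A x.
  move: crA; rewrite /Cr_fun rn => -[d c h].
  by apply: derive1n_Cr_at => //; exact: d.
have cA : continuous A by move=> x; exact: Cr_at_continuous (hA x).
have [m mE] := lift_unique cA cA1 lA lA1.
have incrA : {homo A : x y / x < y} by move=> x y xy; rewrite !mE ltrD2r hA1.
exists A; split => //.
exact: lift_deg1_homeo (can_inj fK) cA incrA lA.
Qed.

Lemma good_lift_comp f (g : circle R -> circle R) A B : good_lift f A -> good_lift g B ->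
  good_lift (f \o g) (A \o B).
Proof.
move=> [lA hA dA rA] [lB hB dB rB]; split.
- by move=> t /=; rewrite lB lA.
- by move=> x y xy /=; apply: hA; exact: hB.
- by move=> x /=; rewrite dB dA.
- by move=> x; apply: Cr_at_comp => //; exact: Cr_at_lipschitz (rB x).
Qed.

Lemma deg1_int A (m : int) x : (forall x, A (x + 1) = A x + 1) ->
  A (x + m%:~R) = A x + m%:~R.
Proof.
move=> dA; pose D t := A t - t.
have DE t : D (t + 1) = D t by rewrite /D dA opprD addrACA subrr addr0.
have := periodic_int m DE x; rewrite /D => E.
by rewrite -[LHS](subrK (x + m%:~R)) E; ring.
Qed.

Lemma good_lift_shift f A (m : int) : good_lift f A ->
  good_lift f (fun t => A t + m%:~R).
Proof.
move=> [lA hA dA rA]; split.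
- exact: lift_shift.
- by move=> x y xy; rewrite ltrD2r hA.
- by move=> x; rewrite dA addrAC.
- by move=> x; apply: Cr_atD => //; exact: Cr_at_cst.
Qed.

Lemma good_lift_id_shift (m : int) : good_lift id (fun t => t + m%:~R).
Proof.
have good_id : good_lift id id by split => // x; exact: Cr_at_id.
exact: good_lift_shift good_id.
Qed.

Section conjugated_actions.
Variables (G : groupType) (theta1 theta2 : G -> circle R -> circle R).
Variables (phi : circle R -> circle R) (F Fi : R -> R).
Hypotheses (act1 : Cr_action r theta1) (act2 : Cr_action r theta2).
Hypothesis hmin : minimal_action theta1.
Hypothesis hfree : non_free_action theta1.
Hypothesis herg : lebesgue_ergodic theta1.
Hypothesis hconj : forall g, phi \o theta1 g = theta2 g \o phi.
Hypotheses (cF : continuous F) (hF : {homo F : x y / x < y}).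
Hypotheses (dF : forall x, F (x + 1) = F x + 1) (lF : circle_lift phi F).
Hypotheses (FK : cancel F Fi) (FiK : cancel Fi F).
Hypothesis lipF : exists2 K, 0 < K & forall x y, `|F x - F y| <= K * `|x - y|.
Hypothesis lipFi : exists2 K, 0 < K & forall x y, `|Fi x - Fi y| <= K * `|x - y|.

(** Each lift alone is determined only up to an integer translation; the intertwining condition ties
    the two integers together, so a pair can only be translated jointly. *)
Definition matched_lifts A B : Prop := (forall x, F (A x) = B (F x)) /\
  exists g, good_lift (theta1 g) A /\ good_lift (theta2 g) B.

(** [F o A] and [B o F] lift the same circle map, so they differ by an integer, which is absorbed
    into [B]. *)
Lemma matched_exists g : exists A B, [/\ matched_lifts A B,
  good_lift (theta1 g) A & good_lift (theta2 g) B].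
Proof.
have [d1 o1] := act1.2 g; have [d2 o2] := act2.2 g.
have [A gA] := good_lift_exists d1 o1; have [B gB] := good_lift_exists d2 o2.
have cA := good_lift_continuous gA; have cB := good_lift_continuous gB.
have [lA _ _ _] := gA; have [lB _ _ _] := gB.
have c1 : continuous (F \o A).
  by move=> x; apply: continuous_comp; [exact: cA | exact: cF].
have c2 : continuous (B \o F).
  by move=> x; apply: continuous_comp; [exact: cF | exact: cB].
have l1 : circle_lift (phi \o theta1 g) (F \o A) by move=> t /=; rewrite lA lF.
have l2 : circle_lift (phi \o theta1 g) (B \o F).
  by move=> t; rewrite hconj /= lF lB.
have [m mE] := lift_unique c1 c2 l1 l2.
have gB' := good_lift_shift m gB.
by exists A, (fun t => B t + m%:~R); split => //; split; [exact: mE | exists g].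
Qed.

Lemma matched_shift A B (m : int) : matched_lifts A B ->
  matched_lifts (fun t => A t + m%:~R) (fun t => B t + m%:~R).
Proof.
move=> [E [g [gA gB]]]; split; first by move=> x; rewrite deg1_int // E.
by exists g; split; exact: good_lift_shift.
Qed.

Lemma matched_comp A B A' B' : matched_lifts A B -> matched_lifts A' B' ->
  matched_lifts (A \o A') (B \o B').
Proof.
move=> [E [g [gA gB]]] [E' [g' [gA' gB']]]; split; first by move=> x /=; rewrite E E'.
exists (g * g')%g; rewrite act1.1.2 act2.1.2.
by split; exact: good_lift_comp.
Qed.

Lemma good_lift_incr_inj f A : good_lift f A -> injective A.
Proof.
move=> [_ hA _ _] s t E; have [/hA|/hA|//] := ltgtP s t; by rewrite E ltxx.
Qed.

(** Lifts for the inverse element compose with [A] to a lift of the identity, an integer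
    translation, which is then subtracted. The cancellations for [B] follow by conjugating with
    [F]. *)
Lemma matched_inv A B : matched_lifts A B -> exists A' B',
  [/\ matched_lifts A' B', cancel A A', cancel A' A, cancel B B' & cancel B' B].
Proof.
move=> [E [g [gA gB]]].
have [A1 [B1 [m1 gA1 gB1]]] := matched_exists g^-1%g.
have cA := good_lift_continuous gA; have cA1 := good_lift_continuous gA1.
have id_cont : continuous (@id R) by move=> x; exact: cvg_id.
have th1 : theta1 g^-1%g \o theta1 g = id by rewrite -act1.1.2 mulVg act1.1.1.
have gAA := good_lift_comp gA1 gA; rewrite th1 in gAA.
have lid : circle_lift (@id (circle R)) (@id R) by [].
have [lAA _ _ _] := gAA.
have [m mE] := lift_unique (good_lift_continuous gAA) id_cont lAA lid.
have mm := matched_shift (- m) m1.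
set A' := (fun t => A1 t + _) in mm; set B' := (fun t => B1 t + _) in mm.
have AK : cancel A A'.
  by move=> t; have := mE t; rewrite /= /A' => ->; rewrite mulrNz addrK.
have A'inj : injective A'.
  by move: mm => [_ [g' [gA' _]]]; exact: good_lift_incr_inj gA'.
have A'K : cancel A' A by move=> t; apply: A'inj; rewrite AK.
have E' := mm.1.
exists A', B'; split => // t; rewrite -(FiK t).
  by rewrite -E -E' AK.
by rewrite -E' -E A'K.
Qed.

Lemma matched_minimal x a b : a < b -> exists A B, matched_lifts A B /\ a < A x < b.
Proof.
move=> ab; pose V : set (circle R) := pr @` [set t | a < t < b].
have preV : pr @^-1` V = \bigcup_(m : int) [set t | a < t - m%:~R < b].
  apply/seteqP; split => t /=.
    move=> [s sab /circle_projP[m sE]]; exists (- m) => //=.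
    by rewrite mulrNz opprK -sE.
  by move=> [m _ tab]; exists (t - m%:~R) => //; rewrite -mulrNz circle_projD.
have oV : open V.
  rewrite circle_openE preV; apply: bigcup_open => m _.
  rewrite (_ : [set t | _] = `](a + m%:~R), (b + m%:~R)[%classic).
    exact: interval_open.
  by apply/seteqP; split => t /=; rewrite in_itv /= ltrBrDr ltrBlDr.
have V0 : V !=set0.
  by exists (pr ((a + b) / 2)), ((a + b) / 2) => //=; apply/andP; split; lra.
have [z [[t tab tE] [g _ gE]]] := hmin (pr x) V0 oV.
have [A [B [mAB gA gB]]] := matched_exists g; have [lA _ _ _] := gA.
have /circle_projP[m mE] : pr t = pr (A x) by rewrite tE -lA gE.
exists (fun t => A t + m%:~R), (fun t => B t + m%:~R).
by rewrite -mE; split => //; exact: matched_shift.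
Qed.

Lemma matched_nonfree :
  exists A B, [/\ matched_lifts A B, exists x, A x = x & exists x, A x <> x].
Proof.
have [g [gid [z gz]]] := hfree; have [t tz] := circle_proj_surj z.
have [A [B [mAB gA gB]]] := matched_exists g; have [lA _ _ _] := gA.
have /circle_projP[m mE] : pr t = pr (A t) by rewrite -lA tz gz.
exists (fun t => A t + m%:~R), (fun t => B t + m%:~R); split.
- exact: matched_shift.
- by exists t.
apply: contrapT => nex; apply: gid; apply/funext => y.
have [s <-] := circle_proj_surj y; rewrite lA /=.
by rewrite -(circle_projD (A s) m); congr pr; apply: contrapT => ns; apply: nex; exists s.
Qed.

(** Each periodic open [O i j] is the full preimage of an open set of the circle, so [E] is the
    preimage of a Borel set, to which ergodicity applies. Applying forward invariance to inverse
    elements gives the equality of sets that it requires. *)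
Lemma matched_ergodic (O : nat -> nat -> set R) : (forall i j, open (O i j)) ->
  (forall i j x, O i j (x + 1) <-> O i j x) ->
  let E := \bigcup_i \bigcap_j O i j in
  (forall A B, matched_lifts A B -> forall x, E x -> E (A x)) ->
  mu (`[0, 1[ `&` E) = 0%E \/ mu (`[0, 1[ `&` E) = 1%E.
Proof.
move=> oO perO E invE.
have perm i j (m : int) x : O i j (x + m%:~R) = O i j x.
  by apply: (@periodic_int _ _ (O i j)) => y; apply/propext; exact: perO.
pose V i j : set (circle R) := pr @` O i j.
have preV i j : pr @^-1` V i j = O i j.
  apply/seteqP; split => t /=; last by exists t.
  by move=> [s Os /circle_projP[m sE]]; rewrite sE perm in Os.
pose S : set (circle R) := \bigcup_i \bigcap_j V i j.
have SE t : S (pr t) <-> E t.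
  split=> -[i _ h]; exists i => // j _; have := h j I.
    by rewrite -[V i j (pr t)]/((pr @^-1` V i j) t) preV.
  by rewrite -[in O i j t]preV.
have bS : <<s open >> S.
  apply: (@bigcupT_measurable _ (g_sigma_algebraType (@open (circle R)))) => i.
  apply: (@bigcapT_measurable _ (g_sigma_algebraType (@open (circle R)))) => j.
  by apply: sub_sigma_algebra; rewrite /= circle_openE preV.
have sub g z : S z -> S (theta1 g z).
  have [t <-] := circle_proj_surj z; move=> /SE Et.
  have [A [B [mAB [lA _ _ _] _]]] := matched_exists g.
  by rewrite lA; apply/SE; exact: invE mAB _ Et.
have invS g : theta1 g @` S = S.
  apply/seteqP; split => z; first by move=> [y Sy <-]; exact: sub.
  move=> Sz; exists (theta1 g^-1%g z); first exact: sub.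
  by rewrite -[LHS]/((theta1 g \o theta1 g^-1%g) z) -act1.1.2 mulgV act1.1.1.
have leb : circle_lebesgue S = mu (`[0, 1[ `&` E).
  by rewrite /circle_lebesgue; congr (mu (_ `&` _)); apply/seteqP; split => t /SE.
have := herg bS invS; rewrite leb => -[->|->]; [by left | right].
rewrite /circle_lebesgue preimage_setT setIT lebesgue_measure_itv /= lte_fin ltr01.
by rewrite -EFinB subr0.
Qed.

Lemma matched_conjugated_lifts : conjugated_lifts al n F Fi matched_lifts.
Proof.
split => //.
- by move=> A B [_ [g [[_ hA _ _] [_ hB _ _]]]].
- by move=> A B [_ [g [[_ _ dA _] [_ _ dB _]]]].
- split; first exact: dF.
  exists 1%g; rewrite act1.1.1 act2.1.1.
  by split; have := good_lift_id_shift 1; rewrite mulr1z.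
- exact: matched_comp.
- exact: matched_inv.
- by move=> A B [_ [g [[_ _ _ rA] [_ _ _ rB]]]].
- by move=> A B [].
- exact: matched_minimal.
- exact: matched_nonfree.
- exact: matched_ergodic.
Qed.

End conjugated_actions.
End good_lifts.

Theorem theoremA (R : realType) (r : R) (G : groupType)
  (theta1 theta2 : G -> circle R -> circle R) (phi : circle R -> circle R)
  (hr : 1 <= r)
  (hG : finitely_generated G)
  (hdiff1 : Cr_action r theta1) (hdiff2 : Cr_action r theta2)
  (hmin1 : minimal_action theta1) (hmin2 : minimal_action theta2)
  (hfree1 : non_free_action theta1) (hfree2 : non_free_action theta2)
  (hphi : bilipschitz_homeo phi) (hphi_or : orientation_preserving phi)
  (hconj : forall g, phi \o theta1 g = theta2 g \o phi)
  (herg1 : lebesgue_ergodic theta1) (herg2 : lebesgue_ergodic theta2) :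
  Cr_diffeo r phi.
Proof.
have r0 : 0 <= r by rewrite (le_trans ler01).
have /andP[r1 r2] := truncn_itv r0.
(* As [r >= 1], at least one derivative is available, and [n] is the order left for the derivative
   of the conjugacy. *)
have [n rn] : exists n, Num.truncn r = n.+1.
  by exists (Num.truncn r).-1; rewrite prednK // truncn_gt0.
rewrite rn in r1 r2.
have al0 : 0 <= r - n.+1%:R by rewrite subr_ge0.
have al01 : 0 <= r - n.+1%:R <= 1.
  by rewrite al0 lerBlDl -natr1 addrC in r2 *; rewrite ltW // addrC.
have [psi [hom lip_phi lip_psi]] := hphi; have [phiK psiK _ _] := hom.
have [F [cF hF lF]] := hphi_or.
have dF := lift_deg1_homeo (can_inj phiK) cF hF lF.
have [Fi [FK FiK hFi cFi]] := incr_deg1_inverse cF hF dF.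
have lFi : circle_lift psi Fi by move=> t; rewrite -{1}(FiK t) -lF phiK.
have dFi := lift_deg1_homeo (can_inj psiK) cFi hFi lFi.
have lipF := lift_lipschitz cF lF lip_phi.
have lipFi := lift_lipschitz cFi lFi lip_psi.
have hconj' g : psi \o theta2 g = theta1 g \o psi.
  apply/funext => z /=; rewrite -{1}(psiK z).
  by rewrite -[theta2 g _]/((theta2 g \o phi) _) -hconj /= phiK.
have H1 := matched_conjugated_lifts rn al01 hdiff1 hdiff2 hmin1 hfree1 herg1 hconj
  cF hF dF lF FK FiK lipF lipFi.
have H2 := matched_conjugated_lifts rn al01 hdiff2 hdiff1 hmin2 hfree2 herg2 hconj'
  cFi hFi dFi lFi FiK FK lipFi lipF.
exists psi; split => //.
  exists F; split => //.
  by apply: (Cr_at_Cr_fun rn al0 dF); exact: conjugacy_regular H1.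
exists Fi; split => //.
by apply: (Cr_at_Cr_fun rn al0 dFi); exact: conjugacy_regular H2.
Qed.
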